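(* Let $\omega=\exp(2\pi i/3)$, $\bar\omega=\omega^2$, and define a degree-$6$ Belyi map $\mathbb{P}^1_{t}\to\mathbb{P}^1_\zeta$ by $$\zeta_{1,2}(t)=\frac{(1+t^3)^2}{4t^3}=1+\frac{(1-t^3)^2}{4t^3}.$$ Put $Y_0=\frac{(1+t)^3}{1+t^3}$, $Y_1=\frac{(1+\omega t)^3}{1+t^3}$, $Y_2=\frac{(1+\bar\omega t)^3}{1+t^3}$. Let the lower parameters $b_1(\kappa),b_2(\kappa)$ be $\frac13,\frac23$ if $\kappa=0$; $\frac23,\frac43$ if $\kappa=1$; $\frac43,\frac53$ if $\kappa=2$. Then for all $a\in\mathbb{C}$, $\ell\in\mathbb{Z}$ and $\kappa=0,1,2$, one has near $t=0$ $${}_3F_{2}\left(\begin{array}{l}-a+\ell+\frac\kappa3;\ \frac{a}{2}+\frac\kappa3,\,\frac{a+1}2+\frac\kappa3\\ b_1(\kappa),\,b_2(\kappa)\end{array}\mid\frac1{\zeta_{1,2}(t)}\right)=\frac{(-1)^\kappa(1)_\kappa(a+2\kappa/3)_{1-\ell-\kappa}}{(a)_{1-\ell}}\left[\frac{4}{27}\,\zeta_{1,2}(t)\right]^{\kappa/3}$$ $$\times\frac13\left\{Y_0^{-a}F_\ell\left(-a,\tfrac13;Y_0\right)+\bar\omega^\kappa\,Y_1^{-a}F_\ell\left(-a,\tfrac13;Y_1\right)+\omega^\kappa\,Y_2^{-a}F_\ell\left(-a,\tfrac13;Y_2\right)\right\}.$$ Moreover, for all $a,c\in\mathbb{C}$,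 $\ell=0,1$ and $\kappa=0,1,2$, one has near $t=0$ $${}_4F_{3}\left(\begin{array}{l}-a+\ell+1+\frac\kappa3;\ \frac{a}{2}+\frac\kappa3,\,\frac{a+1}2+\frac\kappa3;\ -a-c+\ell+\frac\kappa3\\ b_1(\kappa),\,b_2(\kappa);\ -a-c+\ell+1+\frac\kappa3\end{array}\mid\frac1{\zeta_{1,2}(t)}\right)$$ $$=\frac{(-1)^\kappa(1)_\kappa(a+2\kappa/3)_{-\ell-\kappa}(a+c-\ell-\kappa/3)}{(a)_{-\ell}(a+c-\ell)}\left[\frac{4}{27}\,\zeta_{1,2}(t)\right]^{\kappa/3}$$ $$\times\frac13\left\{Y_0^{-a}G_\ell\left(-a,\tfrac13,-c;Y_0\right)+\bar\omega^\kappa\,Y_1^{-a}G_\ell\left(-a,\tfrac13,-c;Y_1\right)+\omega^\kappa\,Y_2^{-a}G_\ell\left(-a,\tfrac13,-c;Y_2\right)\right\}.$$ Here $a$ (and $c$) are assumed to be such that no lower hypergeometric parameter is a non-positive integer and no division by zero occurs.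
   Context: A Belyi map is a holomorphic map to $\mathbb{P}^1_\zeta$ ramified only over $\zeta=0,1,\infty$. Branches: complex powers of quantities near $1$ are principal, and $\left[\frac4{27}\zeta_{1,2}(t)\right]^{1/3}=\frac{(1+t^3)^{2/3}}{3t}$. Notation: ${}_{m}F_{m-1}(a_1,\dots,a_m;b_1,\dots,b_{m-1};\zeta)=\sum_{k\ge0}\frac{(a_1)_k\cdots(a_m)_k}{(b_1)_k\cdots(b_{m-1})_k(1)_k}\zeta^k$. For $c\in\mathbb{C}$, $(c)_r=c(c+1)\cdots(c+r-1)$ for $r\ge0$ and $(c)_{-s}=[(c-s)\cdots(c-1)]^{-1}$ for $s\ge0$; $\binom{c}{r}=(c-r+1)_r/r!$. Rational functions $F_\ell$: for $\ell\in\mathbb{Z}$ and $B\ne0,1$ let $f_\ell(A,B;k)=\frac{(A+Bk+1)_{\ell-1}}{(A+1)_{\ell-1}}$ and $\hat f_\ell(A,B;r)=\sum_{k=0}^r(-1)^k\binom{r}{k}\binom{A+Bk}{r}f_\ell(A,B;k)$. Then $F_\ell(A,B;y)$ is the rational function of $y$ given near $y=1$ by $\sum_{r\ge0}\hat f_\ell(A,B;r)\left(\frac{1-y}{y}\right)^r$. E.g. $F_0\equiv1$, $F_1(A,B;y)=\frac{y}{(1-B)y+B}$. Functions $G_0,G_1$: $G_0(A,B,C;y)={}_2F_1\left(C,1;\frac{A+C}B+1;\frac{y-1}y\right)$ and $G_1(A,B,C;y)=\frac{y}{(1-B)y+B}\;{}_3F_2\left(C,\frac{A+1}{B-1}+1,1;\frac{A+C+1}{B}+1,\frac{A+1}{B-1};\frac{y-1}y\right)$.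 *)

(* Defs.v *)
From Stdlib Require Import Reals Lra Lia ZArith List.
From Coquelicot Require Import Coquelicot.

Open Scope C_scope.

Definition Cexp (z : C) : C :=
  (exp (Re z) * cos (Im z), exp (Re z) * sin (Im z))%R.

(* Argument in (-PI, PI]. *)
Definition Carg (z : C) : R :=
  if Rlt_dec 0 (Re z) then atan (Im z / Re z)
  else if Rlt_dec (Re z) 0 then
    if Rle_dec 0 (Im z) then (atan (Im z / Re z) + PI)%R
    else (atan (Im z / Re z) - PI)%R
  else if Rlt_dec 0 (Im z) then (PI / 2)%R
  else if Rlt_dec (Im z) 0 then (- (PI / 2))%R
  else 0%R.

Definition Clog (z : C) : C := (ln (Cmod z), Carg z).

(* Principal value of z ^ w, meaningful for z <> 0. *)
Definition Cpower (z w : C) : C := Cexp (w * Clog z).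

(* Sum of a complex series, meaningful when the series converges. *)
Definition CSeries (u : nat -> C) : C :=
  (Series (fun n => Re (u n)), Series (fun n => Im (u n))).

(** Pochhammer symbols and binomial coefficients *)

Fixpoint poch (c : C) (r : nat) : C :=
  match r with
  | O => 1
  | S r' => poch c r' * (c + INR r')
  end.

Definition pochZ (c : C) (n : Z) : C :=
  match n with
  | Z0 => 1
  | Zpos p => poch c (Pos.to_nat p)
  | Zneg p => / poch (c - INR (Pos.to_nat p)) (Pos.to_nat p)
  end.

(* [pochZ c n] involves no division by zero. *)
Definition pochZ_defined (c : C) (n : Z) : Prop :=
  match n with
  | Zneg p => poch (c - INR (Pos.to_nat p)) (Pos.to_nat p) <> 0
  | _ => True
  end.

Definition binom (c : C) (r : nat) : C := poch (c - INR r + 1) r / INR (fact r).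

(** Generalized hypergeometric series *)

Definition poch_prod (cs : list C) (k : nat) : C :=
  fold_right Cmult 1 (map (fun c => poch c k) cs).

Definition pFq (upper lower : list C) (z : C) : C :=
  CSeries (fun k =>
    poch_prod upper k / (poch_prod lower k * poch 1 k) * z ^ k).

Definition lower_ok (lower : list C) : Prop :=
  forall b, In b lower -> forall n : nat, b <> - INR n.

(** The functions F_l *)

Definition f_ (l : Z) (A B : C) (k : nat) : C :=
  pochZ (A + B * INR k + 1) (l - 1) / pochZ (A + 1) (l - 1).

(* The product binom (A + B k) r * f_ l A B k, with the factors common to the
   binomial coefficient and to the denominator of f_ (for l <= 0) cancelled,
   i.e. (c-r+1)_r (c+1)_(l-1) = (c-r+1)_(r+l-1) with c = A + B k; see
   [binom_f_E].  This is its value as a rational function of A.  Without the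
   cancellation F_0 = 1 would involve 0/0 whenever A + B k = 0 for some k. *)
Definition binom_f (l : Z) (A B : C) (k r : nat) : C :=
  pochZ (A + B * INR k - INR r + 1) (Z.of_nat r + l - 1) / INR (fact r)
  / pochZ (A + 1) (l - 1).

Definition fhat (l : Z) (A B : C) (r : nat) : C :=
  sum_n (fun k => (- (1)) ^ k * binom (INR r) k * binom_f l A B k r) r.

(* The rational function F_l(A,B;y) is determined by this expansion near
   y = 1; only values near y = 1 are used, and the sum is not meant to be the
   rational function where the series diverges. *)
Definition F_ (l : Z) (A B y : C) : C :=
  CSeries (fun r => fhat l A B r * ((1 - y) / y) ^ r).

(* No division by zero occurs in the coefficients of F_l(A,B;.). *)
Definition F_defined (l : Z) (A B : C) : Prop :=
  pochZ_defined (A + 1) (l - 1) /\ pochZ (A + 1) (l - 1) <> 0 /\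
  forall k r : nat, (k <= r)%nat ->
    pochZ_defined (A + B * INR k - INR r + 1) (Z.of_nat r + l - 1).

(** The functions G_0 and G_1 *)

Definition G0_lower (A B D : C) : list C := ((A + D) / B + 1) :: nil.

Definition G0 (A B D y : C) : C :=
  pFq (D :: RtoC 1 :: nil) (G0_lower A B D) ((y - 1) / y).

Definition G1_lower (A B D : C) : list C :=
  ((A + D + 1) / B + 1) :: ((A + 1) / (B - 1)) :: nil.

Definition G1 (A B D y : C) : C :=
  y / ((1 - B) * y + B) *
  pFq (D :: ((A + 1) / (B - 1) + 1) :: RtoC 1 :: nil) (G1_lower A B D)
      ((y - 1) / y).

Definition G_ (l : Z) : C -> C -> C -> C -> C :=
  if Z.eqb l 0 then G0 else G1.

Definition G_lower (l : Z) : C -> C -> C -> list C :=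
  if Z.eqb l 0 then G0_lower else G1_lower.

(** Belyi maps; in [P1] the point at infinity is [None] *)

Definition P1 : Type := option C.

(* The involution z |-> 1/z. *)
Definition P1inv (p : P1) : P1 :=
  match p with
  | None => Some (RtoC 0)
  | Some z => if Ceq_dec z 0 then None else Some (/ z)
  end.

(* The two charts of P1, where [None] is the point outside the chart; the chart
   maps are involutions. *)
Definition chart (s : bool) (p : P1) : P1 := if s then P1inv p else p.

Definition P1fin (p : P1) : C := match p with Some z => z | None => 0 end.

(* [d] is the derivative at [p] of [f] read in some pair of charts. *)
Definition has_chart_derivative (f : P1 -> P1) (p : P1) (d : C) : Prop :=
  exists (s s' : bool) (z : C),
    chart s (Some z) = p /\
    (exists eps : R, (0 < eps)%R /\ forall w : C, (Cmod (w - z) < eps)%R ->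
       chart s' (f (chart s (Some w))) <> None) /\
    is_derive (K := C_AbsRing) (V := C_NormedModule)
      (fun w : C => P1fin (chart s' (f (chart s (Some w))))) z d.

Definition P1_holomorphic (f : P1 -> P1) : Prop :=
  forall p, exists d, has_chart_derivative f p d.

Definition ramified_at (f : P1 -> P1) (p : P1) : Prop :=
  has_chart_derivative f p 0.

Definition Belyi (f : P1 -> P1) : Prop :=
  P1_holomorphic f /\
  forall p, ramified_at f p ->
    f p = Some (RtoC 0) \/ f p = Some (RtoC 1) \/ f p = None.

(* The degree as the number of points of all but finitely many fibres. *)
Definition P1_degree (f : P1 -> P1) (n : nat) : Prop :=
  exists exceptional : list P1, forall q : P1, ~ In q exceptional ->
    exists fibre : list P1,
      NoDup fibre /\ length fibre = n /\ forall p, In p fibre <-> f p = q.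

(** The map zeta_{1,2} and the functions Y_j *)

Definition zeta12 (t : C) : C := (1 + t ^ 3) ^ 2 / (4 * t ^ 3).

Definition zeta12_P1 (p : P1) : P1 :=
  match p with
  | None => None
  | Some t => if Ceq_dec t 0 then None else Some (zeta12 t)
  end.

(* The chosen branch of (4/27 zeta12 t) ^ (1/3). *)
Definition zeta12_root (t : C) : C :=
  Cpower (1 + t ^ 3) (2 / 3) / (3 * t).

Definition omega : C := Cexp (2 * PI * Ci / 3).
Definition omegabar : C := omega ^ 2.

Definition Y0 (t : C) : C := (1 + t) ^ 3 / (1 + t ^ 3).
Definition Y1 (t : C) : C := (1 + omega * t) ^ 3 / (1 + t ^ 3).
Definition Y2 (t : C) : C := (1 + omegabar * t) ^ 3 / (1 + t ^ 3).

(* The pair b_1, b_2; only kappa = 0, 1, 2 is meaningful. *)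
Definition b_lower (kappa : nat) : list C :=
  match kappa with
  | 0%nat => 1 / 3 :: 2 / 3 :: nil
  | 1%nat => 2 / 3 :: 4 / 3 :: nil
  | _ => 4 / 3 :: 5 / 3 :: nil
  end.

(** Agreement of [binom_f] with the product of its factors *)

Lemma poch_S_l (c : C) (r : nat) : poch c (S r) = c * poch (c + 1) r.
Proof.
  induction r as [|r IH].
  - simpl; ring.
  - change (poch c (S (S r))) with (poch c (S r) * (c + INR (S r))).
    rewrite IH, S_INR, RtoC_plus.
    change (poch (c + 1) (S r)) with (poch (c + 1) r * (c + 1 + INR r)).
    ring.
Qed.

Lemma pochZ_nat (c : C) (r : nat) : pochZ c (Z.of_nat r) = poch c r.
Proof.
  destruct r as [|r]; [reflexivity|].
  change (poch c (Pos.to_nat (Pos.of_succ_nat r)) = poch c (S r)).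
  now rewrite SuccNat2Pos.id_succ.
Qed.

Lemma pochZ_opp (c : C) (s : nat) :
  pochZ c (- Z.of_nat s) = / poch (c - INR s) s.
Proof.
  destruct s as [|s].
  - simpl. field.
  - change (/ poch (c - INR (Pos.to_nat (Pos.of_succ_nat s)))
                   (Pos.to_nat (Pos.of_succ_nat s)) = / poch (c - INR (S s)) (S s)).
    now rewrite SuccNat2Pos.id_succ.
Qed.

Lemma pochZ_defined_opp (c : C) (s : nat) :
  pochZ_defined c (- Z.of_nat s) -> poch (c - INR s) s <> 0.
Proof.
  destruct s as [|s].
  - intros _. simpl. apply C1_nz.
  - change (- Z.of_nat (S s))%Z with (Zneg (Pos.of_succ_nat s)).
    unfold pochZ_defined. now rewrite SuccNat2Pos.id_succ.
Qed.

Lemma opp_pochZ_defined (c : C) (s : nat) :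
  poch (c - INR s) s <> 0 -> pochZ_defined c (- Z.of_nat s).
Proof.
  destruct s as [|s]; [easy|].
  change (- Z.of_nat (S s))%Z with (Zneg (Pos.of_succ_nat s)).
  unfold pochZ_defined. now rewrite SuccNat2Pos.id_succ.
Qed.

Lemma pochZ_step (x : C) (n : Z) :
  pochZ_defined (x + 1) n ->
  pochZ_defined x (n + 1) /\ x * pochZ (x + 1) n = pochZ x (n + 1).
Proof.
  intros H.
  destruct (Z_le_gt_dec 0 n) as [Hn|Hn].
  - rewrite <- (Z2Nat.id n Hn) in *. set (r := Z.to_nat n) in *.
    replace (Z.of_nat r + 1)%Z with (Z.of_nat (S r)) by lia.
    split; [exact I|].
    now rewrite !pochZ_nat, poch_S_l.
  - set (s := Z.to_nat (- n - 1)).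
    assert (E : n = (- Z.of_nat (S s))%Z) by (unfold s; lia).
    rewrite E in *. clear E Hn. clearbody s.
    replace (- Z.of_nat (S s) + 1)%Z with (- Z.of_nat s)%Z by lia.
    apply pochZ_defined_opp in H.
    assert (E : poch (x + 1 - INR (S s)) (S s) = poch (x - INR s) s * x).
    { replace (x + 1 - INR (S s)) with (x - INR s)
        by (rewrite S_INR, RtoC_plus; ring).
      simpl. f_equal. ring. }
    rewrite E in H.
    assert (Hp : poch (x - INR s) s <> 0) by (intros K; apply H; rewrite K; ring).
    assert (Hx : x <> 0) by (intros K; apply H; rewrite K; ring).
    split; [now apply opp_pochZ_defined|].
    rewrite !pochZ_opp, E. now field.
Qed.

Lemma pochZ_add (m : nat) (x : C) (n : Z) :
  pochZ_defined (x + INR m) n ->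
  pochZ_defined x (Z.of_nat m + n) /\
  poch x m * pochZ (x + INR m) n = pochZ x (Z.of_nat m + n).
Proof.
  revert x. induction m as [|m IH]; intros x H.
  - replace (x + INR 0) with x in * by (simpl; ring).
    simpl in *. split; [exact H|ring].
  - replace (x + INR (S m)) with (x + 1 + INR m) in *
      by (rewrite S_INR, RtoC_plus; ring).
    destruct (IH _ H) as [D E].
    destruct (pochZ_step _ _ D) as [D' E'].
    replace (Z.of_nat (S m) + n)%Z with (Z.of_nat m + n + 1)%Z by lia.
    split; [exact D'|].
    rewrite <- E', <- E, poch_S_l. ring.
Qed.

Lemma binom_f_E (l : Z) (A B : C) (k r : nat) :
  pochZ_defined (A + B * INR k + 1) (l - 1) ->
  binom_f l A B k r = binom (A + B * INR k) r * f_ l A B k.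
Proof.
  intros H. unfold binom_f, binom, f_, Cdiv.
  set (c := A + B * INR k) in *.
  replace (c + 1) with (c - INR r + 1 + INR r) in * by ring.
  destruct (pochZ_add r (c - INR r + 1) (l - 1) H) as [_ E].
  replace (Z.of_nat r + l - 1)%Z with (Z.of_nat r + (l - 1))%Z by lia.
  rewrite <- E. ring.
Qed.

(* Main.v *)
(** With y = 1/(1+w), B = 1/3 and z = (y - 1) y^(-B) = - w (1 + w)^(B - 1), expanding all powers
    of 1 + w in y^(-A) sum_k c_k z^k by the binomial series gives a power series in
    w = (1 - y)/y whose coefficients are finite differences of c_k.  For
    c_k = binom(A + Bk, k) f_l(k) this is the definition of F_l; with an additional
    factor 1/(k + x) the finite differences are evaluated by splitting off the pole
    at k = -x, and the result is G_l.

    The points y = Y_j(t) have z = omega^j Z with Z = 3t (1 + t^3)^(-2/3), and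
    Z^3 = (27/4) / zeta_{1,2}(t).  So the weighted sum over the three Y_j keeps exactly
    the terms k = 3m + kappa, and these c_k are, up to a constant, the coefficients of
    the 3F2, respectively 4F3. *)

Require Import Defs.
From Stdlib Require Import Reals ZArith List Lra Lia.
From Coquelicot Require Import Coquelicot.

Open Scope C_scope.

(** Principal powers are not multiplicative, so powers of 1 + w are written
    [Cexp (c * Clog (1 + w))] and t is kept so small that the logarithms of 1 + t, 1 + t^3 and 1 + w
    combine without a multiple of 2 PI. Small radii also give the double series a majorant
    (1/2)^(k+s), which makes the rearrangement elementary.

    G_l is built on the coefficients of F_(l+1). For l = 0 the numerator under the r-th finite
    difference has degree r, so only the pole contributes. For l = 1 it has degree r + 1, and its
    leading term leaves an extra geometric series, which the factor 1 + B w = ((1 - B) y + B) / y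
    removes.

    The coefficients c_(3m+kappa) are never put in closed form. As 3 (B - 1) = -2 is an integer,
    those of F_l satisfy a two-term recurrence in m, which is that of the 3F2; the constant in front
    is the reciprocal of the first of them. The 4F3 adds only the factor p / (p + m). *)

Local Notation cseries := (@is_series C_AbsRing C_NormedModule).

(** * Complex series *)

(** The series lemmas yield equalities typed in a structure whose carrier is merely convertible to
    [C]; [ring] needs the type restated. *)
Ltac cring := match goal with |- @eq _ ?a ?b => change (@eq C a b); ring end.

Lemma Cmod_minus_sym (x y : C) : Cmod (x - y) = Cmod (y - x).
Proof. rewrite <- Cmod_opp. f_equal. cring. Qed.

Lemma cseries_eps (u : nat -> C) (L : C) :
  cseries u L <->
  forall eps : R, (0 < eps)%R -> exists N : nat, forall n : nat, (N <= n)%nat ->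
    (Cmod (sum_n u n - L) < eps)%R.
Proof.
  unfold is_series. split.
  - intros H eps He.
    assert (H1 := proj1 (filterlim_locally_ball_norm _ _) H (mkposreal _ He)).
    destruct H1 as [N HN]. exists N. intros n Hn.
    exact (HN n Hn).
  - intros H. apply (proj2 (filterlim_locally_ball_norm _ _)).
    intros eps. destruct (H eps (cond_pos eps)) as [N HN].
    exists N. intros n Hn. exact (HN n Hn).
Qed.

Lemma Re_sum_n (u : nat -> C) (n : nat) : Re (sum_n u n) = sum_n (fun k => Re (u k)) n.
Proof.
  induction n as [|n IH]; [now rewrite !sum_O|].
  now rewrite !sum_Sn, <- IH.
Qed.

Lemma Im_sum_n (u : nat -> C) (n : nat) : Im (sum_n u n) = sum_n (fun k => Im (u k)) n.
Proof.
  induction n as [|n IH]; [now rewrite !sum_O|].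
  now rewrite !sum_Sn, <- IH.
Qed.

Lemma im_le_Cmod (z : C) : (Rabs (Im z) <= Cmod z)%R.
Proof. apply Rle_trans with (2 := Rmax_Cmod z). apply Rmax_r. Qed.

Lemma cseries_Re (u : nat -> C) (L : C) :
  cseries u L -> is_series (fun k => Re (u k)) (Re L).
Proof.
  intros H. rewrite cseries_eps in H.
  apply (proj2 (filterlim_locally_ball_norm _ _)). intros eps.
  destruct (H eps (cond_pos eps)) as [N HN].
  exists N. intros n Hn. unfold ball_norm.
  rewrite <- Re_sum_n. apply Rle_lt_trans with (2 := HN n Hn).
  exact (re_le_Cmod (sum_n u n - L)).
Qed.

Lemma cseries_Im (u : nat -> C) (L : C) :
  cseries u L -> is_series (fun k => Im (u k)) (Im L).
Proof.
  intros H. rewrite cseries_eps in H.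
  apply (proj2 (filterlim_locally_ball_norm _ _)). intros eps.
  destruct (H eps (cond_pos eps)) as [N HN].
  exists N. intros n Hn. unfold ball_norm.
  rewrite <- Im_sum_n. apply Rle_lt_trans with (2 := HN n Hn).
  exact (im_le_Cmod (sum_n u n - L)).
Qed.

(** [CSeries] is defined by components and has junk values under divergence; the evaluations of
    [CSeries] below all go through actual convergence in [C]. *)
Lemma CSeries_unique (u : nat -> C) (L : C) : cseries u L -> CSeries u = L.
Proof.
  intros H. unfold CSeries.
  rewrite (is_series_unique _ _ (cseries_Re _ _ H)),
    (is_series_unique _ _ (cseries_Im _ _ H)).
  now destruct L.
Qed.

Lemma cseries_unique (u : nat -> C) (L L' : C) : cseries u L -> cseries u L' -> L = L'.
Proof. intros H H'. now rewrite <- (CSeries_unique _ _ H), (CSeries_unique _ _ H'). Qed.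

Lemma cseries_val (u : nat -> C) (L L' : C) : cseries u L -> L = L' -> cseries u L'.
Proof. now intros H <-. Qed.

Lemma cseries_ext (u v : nat -> C) (L : C) :
  (forall n, u n = v n) -> cseries u L -> cseries v L.
Proof. exact (is_series_ext u v L). Qed.

Lemma cseries_scal (c : C) (u : nat -> C) (L : C) :
  cseries u L -> cseries (fun n => c * u n) (c * L).
Proof. exact (is_series_scal (V := C_NormedModule) c u L). Qed.

Lemma cseries_plus (u v : nat -> C) (L M : C) :
  cseries u L -> cseries v M -> cseries (fun n => u n + v n) (L + M).
Proof. exact (is_series_plus u v L M). Qed.

Lemma csum_S (u : nat -> C) (n : nat) : sum_n u (S n) = sum_n u n + u (S n).
Proof. exact (sum_Sn u n). Qed.

Lemma csum_shift (u : nat -> C) (n : nat) :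
  sum_n u (S n) = u O + sum_n (fun k => u (S k)) n.
Proof.
  induction n as [|n IH].
  - now rewrite csum_S, !sum_O.
  - rewrite csum_S, IH, csum_S. cring.
Qed.

Lemma Cmod_sum_n (u : nat -> C) (v : nat -> R) (n : nat) :
  (forall k, (k <= n)%nat -> (Cmod (u k) <= v k)%R) -> (Cmod (sum_n u n) <= sum_n v n)%R.
Proof.
  induction n as [|n IH]; intros H.
  - rewrite !sum_O. apply H. lia.
  - rewrite csum_S, sum_Sn. apply Rle_trans with (1 := Cmod_triangle _ _).
    apply Rplus_le_compat; [apply IH; intros; apply H; lia|apply H; lia].
Qed.

Lemma sum_n_geom_le (K q : R) (n : nat) :
  (0 <= K)%R -> (0 <= q < 1)%R -> (sum_n (fun k => K * q ^ k)%R n <= K / (1 - q))%R.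
Proof.
  intros HK Hq.
  assert (E : sum_n (fun k => K * q ^ k)%R n = (K * (1 - q ^ S n) / (1 - q))%R).
  { induction n as [|n IH].
    - rewrite sum_O. simpl. field. lra.
    - rewrite sum_Sn, IH. unfold plus; simpl. field. lra. }
  rewrite E. apply Rmult_le_compat_r; [left; apply Rinv_0_lt_compat; lra|].
  assert (0 <= q ^ S n)%R by (apply pow_le; lra). nra.
Qed.

Lemma cseries_Cmod_le (u : nat -> C) (L : C) (B : R) :
  cseries u L -> (forall n, (Cmod (sum_n u n) <= B)%R) -> (Cmod L <= B)%R.
Proof.
  intros H HB. apply le_epsilon. intros eps He.
  rewrite cseries_eps in H. destruct (H eps He) as [N HN].
  specialize (HN N (le_n _)). specialize (HB N).
  rewrite Cmod_minus_sym in HN.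
  replace L with ((L - sum_n u N) + sum_n u N) by cring.
  apply Rle_trans with (1 := Cmod_triangle _ _). lra.
Qed.

Lemma cseries_geom_bound (u : nat -> C) (K q : R) :
  (0 <= q < 1)%R -> (forall k, (Cmod (u k) <= K * q ^ k)%R) ->
  exists L, cseries u L /\ (Cmod L <= K / (1 - q))%R.
Proof.
  intros Hq H.
  assert (HK : (0 <= K)%R).
  { specialize (H O). simpl in H. assert (G := Cmod_ge_0 (u O)). lra. }
  assert (Hex : ex_series (V := C_CompleteNormedModule) u).
  { apply (ex_series_le (V := C_CompleteNormedModule) u (fun k => K * q ^ k)%R).
    - intros n. apply H.
    - apply (ex_series_scal (V := R_NormedModule) K (fun k => q ^ k)%R).
      apply ex_series_geom. rewrite Rabs_pos_eq; lra. }
  destruct Hex as [L HL]. exists L. split; [exact HL|].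
  apply (cseries_Cmod_le u L _ HL). intros n.
  apply Rle_trans with (1 := Cmod_sum_n u _ n (fun k _ => H k)).
  now apply sum_n_geom_le.
Qed.

Lemma cseries_tail (u : nat -> C) (L : C) (n : nat) :
  cseries u L -> cseries (fun k => u (n + S k)%nat) (L - sum_n u n).
Proof.
  intros H. apply (cseries_ext (fun k => u (S n + k)%nat)).
  { intros k. f_equal. lia. }
  apply (is_series_incr_n (V := C_NormedModule) u (S n)); [lia|].
  apply (cseries_val u L _ H).
  change (L = L - sum_n u n + sum_n u n). cring.
Qed.

Lemma pow_small (q eps : R) : (0 <= q < 1)%R -> (0 < eps)%R ->
  exists N : nat, forall n, (N <= n)%nat -> (q ^ n < eps)%R.
Proof.
  intros Hq He.
  destruct (pow_lt_1_zero q (ltac:(rewrite Rabs_pos_eq; lra)) eps He) as [N HN].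
  exists N. intros n Hn. apply Rle_lt_trans with (2 := HN n Hn). apply Rle_abs.
Qed.

(** Since n + 1 <= 2 (3/2)^n, the linear factor costs only a weaker ratio, 3/4 in place of 1/2. It
    bounds n + 1 row tails of size (1/2)^n in [cseries_antidiag]. *)
Lemma lin_pow_half_small (K eps : R) : (0 <= K)%R -> (0 < eps)%R ->
  exists N : nat, forall n, (N <= n)%nat -> (K * INR (S n) * (1/2) ^ n < eps)%R.
Proof.
  intros HK He.
  assert (H : forall n : nat, (INR (S n) * (1/2) ^ n <= 2 * (3/4) ^ n)%R).
  { intros n. assert (G : forall n : nat, (INR (S n) <= 2 * (3/2) ^ n)%R).
    { induction n0 as [|m IH]; [simpl; lra|].
      rewrite S_INR. assert (1 <= (3/2) ^ m)%R by (apply pow_R1_Rle; lra).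
      simpl pow. lra. }
    apply Rle_trans with (2 * (3 / 2) ^ n * (1 / 2) ^ n)%R.
    - apply Rmult_le_compat_r; [apply pow_le; lra|apply G].
    - rewrite Rmult_assoc, <- Rpow_mult_distr.
      right. f_equal. f_equal. lra. }
  (* The summand 1 keeps the denominator positive when K = 0. *)
  destruct (pow_small (3/4) (eps / (2 * K + 1)) ltac:(lra)) as [N HN].
  { apply Rdiv_lt_0_compat; lra. }
  exists N. intros n Hn. specialize (HN n Hn). specialize (H n).
  apply Rle_lt_trans with ((2 * K) * (3/4) ^ n)%R.
  { rewrite Rmult_assoc. nra. }
  assert (0 < (3/4) ^ n)%R by (apply pow_lt; lra).
  apply Rmult_lt_compat_r with (r := (2 * K + 1)%R) in HN; [|lra].
  replace (eps / (2 * K + 1) * (2 * K + 1))%R with eps in HN by (field; lra). nra.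
Qed.

Lemma sum_n_split_minus (u v : nat -> C) (n : nat) :
  sum_n u n - sum_n v n = sum_n (fun k => u k - v k) n.
Proof.
  induction n as [|n IH]; [now rewrite !sum_O|].
  rewrite !csum_S, <- IH. cring.
Qed.

Lemma csum_ext_le (u v : nat -> C) (n : nat) :
  (forall k, (k <= n)%nat -> u k = v k) -> sum_n u n = sum_n v n.
Proof. exact (sum_n_ext_loc u v n). Qed.

(** Both sides run over the triangle k + s <= n; a step of n adds the same diagonal to each. *)
Lemma csum_antidiag (a : nat -> nat -> C) (n : nat) :
  sum_n (fun r => sum_n (fun k => a k (r - k)%nat) r) n
  = sum_n (fun k => sum_n (fun s => a k s) (n - k)) n.
Proof.
  induction n as [|n IH]; [now rewrite !sum_O|].
  rewrite csum_S, IH. rewrite (csum_S (fun k => sum_n (fun s => a k s) (S n - k))).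
  rewrite Nat.sub_diag, sum_O.
  rewrite (csum_S (fun k => a k (S n - k)%nat)), Nat.sub_diag.
  rewrite Cplus_assoc. f_equal.
  rewrite (csum_ext_le (fun k => sum_n (fun s => a k s) (S n - k))
    (fun k => sum_n (fun s => a k s) (n - k) + a k (S n - k)%nat)).
  - symmetry. exact (sum_n_plus (G := C_AbelianGroup) _ _ n).
  - intros k Hk. replace (S n - k)%nat with (S (n - k)) by lia. apply csum_S.
Qed.

Lemma csum_const (v : R) (n : nat) : sum_n (fun _ => v) n = (INR (S n) * v)%R.
Proof. exact (sum_n_const n v). Qed.

(** The triangle k + s <= n differs from the first n + 1 complete rows by n + 1 row tails. The tail
    of row k beyond s = n - k is at most 2 K (1/2)^n, so the difference tends to 0. *)
Lemma cseries_antidiag (a : nat -> nat -> C) (U : nat -> C) (K : R) :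
  (forall k s, (Cmod (a k s) <= K * (1/2) ^ (k + s))%R) ->
  (forall k, cseries (a k) (U k)) ->
  exists L, cseries U L /\ cseries (fun r => sum_n (fun k => a k (r - k)%nat) r) L.
Proof.
  intros H HU.
  assert (HK : (0 <= K)%R).
  { specialize (H O O). simpl in H. assert (G := Cmod_ge_0 (a O O)). lra. }
  assert (Htail : forall k n, (Cmod (U k - sum_n (a k) n) <= 2 * K * (1/2) ^ (k + n))%R).
  { intros k n. assert (T := cseries_tail _ _ n (HU k)).
    destruct (cseries_geom_bound (fun j => a k (n + S j)%nat) (K * (1/2) ^ (k + n)) (1/2))
      as [L [HL HB]]; [lra| |].
    - intros j. apply Rle_trans with (1 := H k _).
      replace (k + (n + S j))%nat with (S (k + n + j)) by lia.
      rewrite Rmult_assoc, <- pow_add. apply Rmult_le_compat_l; [exact HK|].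
      simpl. assert (0 <= (1/2) ^ (k + n + j))%R by (apply pow_le; lra). lra.
    - rewrite (cseries_unique _ _ _ T HL). apply Rle_trans with (1 := HB). right. field. }
  assert (HUb : forall k, (Cmod (U k) <= 2 * K * (1/2) ^ k)%R).
  { intros k. apply (cseries_Cmod_le (a k)); [apply HU|]. intros n.
    apply Rle_trans with (sum_n (fun s => K * (1/2) ^ k * (1/2) ^ s)%R n).
    - apply Cmod_sum_n. intros s _. apply Rle_trans with (1 := H k s).
      rewrite pow_add. right. ring.
    - assert (0 <= (1/2) ^ k)%R by (apply pow_le; lra).
      apply Rle_trans with (1 := sum_n_geom_le (K * (1/2) ^ k) (1/2) n ltac:(nra) ltac:(lra)).
      right. field. }
  destruct (cseries_geom_bound U (2 * K) (1/2) ltac:(lra) HUb) as [L [HL _]].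
  exists L. split; [exact HL|].
  rewrite cseries_eps in *. intros eps He.
  destruct (HL (eps / 2)%R ltac:(lra)) as [N1 HN1].
  destruct (lin_pow_half_small (2 * K) (eps / 2) ltac:(lra) ltac:(lra)) as [N2 HN2].
  exists (N1 + N2)%nat. intros n Hn.
  specialize (HN1 n ltac:(lia)). specialize (HN2 n ltac:(lia)).
  rewrite csum_antidiag.
  replace (sum_n (fun k => sum_n (fun s => a k s) (n - k)) n - L)
    with ((sum_n U n - L) - (sum_n U n - sum_n (fun k => sum_n (fun s => a k s) (n - k)) n))
    by cring.
  rewrite sum_n_split_minus.
  apply Rle_lt_trans with (1 := Cmod_triangle _ _). rewrite Cmod_opp.
  assert (Hd : (Cmod (sum_n (fun k => U k - sum_n (fun s => a k s) (n - k)%nat)%C n)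
     <= INR (S n) * (2 * K * (1/2) ^ n))%R).
  { rewrite <- csum_const. apply Cmod_sum_n. intros k Hk.
    apply Rle_trans with (1 := Htail k (n - k)%nat). right.
    now replace (k + (n - k))%nat with n by lia. }
  lra.
Qed.

(** * Pochhammer symbols, logarithms and the binomial series *)

(** The bound binom(k+j, k) <= 2^(k+j) with denominators cleared. The inductive step is Pascal's
    rule: (k+j+2)! = ((k+1) + (j+1)) (k+j+1)!, one induction hypothesis for each summand. *)
Lemma fact_plus_le (k j : nat) :
  (INR (fact (k + j)) <= INR (fact k) * INR (fact j) * 2 ^ (k + j))%R.
Proof.
  revert j. induction k as [|k IHk]; intros j.
  - change (fact 0) with 1%nat. change (0 + j)%nat with j. rewrite INR_1, Rmult_1_l.
    assert (H1 : (1 <= 2 ^ j)%R) by (apply pow_R1_Rle; lra).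
    assert (H2 := INR_fact_lt_0 j). revert H1 H2.
    generalize (2 ^ j)%R (INR (fact j)). intros. nra.
  - induction j as [|j IHj].
    + rewrite Nat.add_0_r. change (fact 0) with 1%nat. rewrite INR_1, Rmult_1_r.
      assert (H1 : (1 <= 2 ^ S k)%R) by (apply pow_R1_Rle; lra).
      assert (H2 := INR_fact_lt_0 (S k)). revert H1 H2.
      generalize (2 ^ S k)%R (INR (fact (S k))). intros. nra.
    + specialize (IHk (S j)).
      replace (k + S j)%nat with (S k + j)%nat in IHk by lia.
      replace (S k + S j)%nat with (S (S k + j)) by lia.
      set (n := (S k + j)%nat) in *.
      rewrite !fact_simpl, !mult_INR. rewrite fact_simpl, mult_INR in IHj.
      rewrite fact_simpl, mult_INR in IHk.
      assert (E : (INR (S n) = INR (S k) + INR (S j))%R).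
      { rewrite <- plus_INR. f_equal. unfold n. lia. }
      rewrite E. change (2 ^ S n)%R with (2 * 2 ^ n)%R.
      assert (Hk : (0 < INR (S k))%R) by (apply lt_0_INR; lia).
      assert (Hj : (0 < INR (S j))%R) by (apply lt_0_INR; lia).
      apply (Rmult_le_compat_l (INR (S k))) in IHk; [|lra].
      apply (Rmult_le_compat_l (INR (S j))) in IHj; [|lra].
      lra.
Qed.

Lemma Cmod_INR (n : nat) : Cmod (INR n) = INR n.
Proof. rewrite Cmod_R. apply Rabs_pos_eq, pos_INR. Qed.

Lemma INR_fact_C (n : nat) : RtoC (INR (fact n)) <> 0.
Proof. intros H. apply RtoC_inj in H. exact (INR_fact_neq_0 n H). Qed.

(** The i-th factor satisfies |c + i| <= M + 1 + i, and these bounds multiply to (M + n)! / M!. *)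
Lemma Cmod_poch_fact (c : C) (M n : nat) :
  (Cmod c <= INR M + 1)%R -> (Cmod (poch c n) * INR (fact M) <= INR (fact (M + n)))%R.
Proof.
  intros Hc. induction n as [|n IH].
  - simpl poch. rewrite Cmod_1, Nat.add_0_r. lra.
  - simpl poch. rewrite Cmod_mult. rewrite Nat.add_succ_r, fact_simpl, mult_INR.
    assert (Cmod (c + INR n) <= INR (S (M + n)))%R.
    { apply Rle_trans with (1 := Cmod_triangle _ _).
      rewrite Cmod_INR, S_INR, plus_INR. lra. }
    assert (0 <= Cmod (c + INR n))%R by apply Cmod_ge_0.
    assert (0 <= Cmod (poch c n))%R by apply Cmod_ge_0.
    assert (0 < INR (fact M))%R by apply INR_fact_lt_0. 
    replace (Cmod (poch c n) * Cmod (c + INR n) * INR (fact M))%R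
      with (Cmod (c + INR n) * (Cmod (poch c n) * INR (fact M)))%R by ring.
    apply Rmult_le_compat; nra.
Qed.

Lemma Cmod_poch_le (c : C) (M n : nat) :
  (Cmod c <= INR M + 1)%R -> (Cmod (poch c n) <= INR (fact n) * 2 ^ (M + n))%R.
Proof.
  intros Hc. assert (H := Cmod_poch_fact c M n Hc). assert (G := fact_plus_le M n).
  assert (0 < INR (fact M))%R by apply INR_fact_lt_0.
  apply Rmult_le_reg_r with (INR (fact M)); [assumption|]. nra.
Qed.

Lemma poch_reflect (c : C) (n : nat) : poch (c - INR n + 1) n = (- (1)) ^ n * poch (- c) n.
Proof.
  induction n as [|n IH]; [simpl; ring|].
  rewrite poch_S_l. replace (c - INR (S n) + 1 + 1) with (c - INR n + 1)
    by (rewrite S_INR, RtoC_plus; ring).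
  rewrite IH, Cpow_S. simpl poch. rewrite S_INR, RtoC_plus. ring.
Qed.

(** The bound is exponential in the size of c as well as in n. The resummation depends on this,
    because its upper entry A + (B - 1) k grows with k. *)
Lemma Cmod_binom_le (c : C) (M n : nat) :
  (Cmod c <= INR M + 1)%R -> (Cmod (binom c n) <= 2 ^ (M + n))%R.
Proof.
  intros Hc. unfold binom. rewrite Cmod_div by apply INR_fact_C.
  rewrite poch_reflect, Cmod_mult, Cmod_pow, Cmod_m1, pow1, Rmult_1_l, Cmod_INR.
  assert (0 < INR (fact n))%R by apply INR_fact_lt_0.
  apply Rmult_le_reg_r with (INR (fact n)); [assumption|].
  unfold Rdiv. rewrite Rmult_assoc, Rinv_l, Rmult_1_r by lra.
  rewrite Rmult_comm. apply Cmod_poch_le. now rewrite Cmod_opp.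
Qed.

Lemma binom_0 (c : C) : binom c 0 = 1.
Proof. unfold binom. simpl. field. Qed.

Lemma binom_S (c : C) (n : nat) : (INR n + 1) * binom c (S n) = (c - INR n) * binom c n.
Proof.
  unfold binom. rewrite poch_S_l.
  replace (c - INR (S n) + 1 + 1) with (c - INR n + 1)
    by (rewrite S_INR, RtoC_plus; ring).
  rewrite fact_simpl, mult_INR, S_INR, RtoC_mult, RtoC_plus.
  assert (H := INR_fact_C n).
  assert (RtoC (INR n) + 1 <> 0).
  { rewrite <- RtoC_plus. intros E. apply RtoC_inj in E. assert (G := pos_INR n). lra. }
  field. now split.
Qed.

(** * Complex exponential and principal logarithm *)

Lemma Cexp_plus (u v : C) : Cexp (u + v) = Cexp u * Cexp v.
Proof.
  unfold Cexp. destruct u as [a b], v as [c d]. simpl.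
  rewrite exp_plus, cos_plus, sin_plus. unfold Cmult; simpl. f_equal; ring.
Qed.

Lemma Cexp_0 : Cexp 0 = 1.
Proof. unfold Cexp. simpl. rewrite exp_0, cos_0, sin_0. unfold RtoC. f_equal; ring. Qed.

Lemma Cexp_nz (u : C) : Cexp u <> 0.
Proof.
  intros H. apply C1_nz. rewrite <- Cexp_0. replace (RtoC 0) with (u + - u) by ring.
  rewrite Cexp_plus, H. ring.
Qed.

Lemma Cexp_opp (u : C) : Cexp (- u) = / Cexp u.
Proof.
  assert (H := Cexp_nz u).
  assert (E : Cexp u * Cexp (- u) = 1).
  { rewrite <- Cexp_plus, <- Cexp_0. f_equal. ring. }
  rewrite <- (Cmult_1_l (/ Cexp u)), <- E. now field.
Qed.

Lemma Cexp_INR (u : C) (n : nat) : Cexp (INR n * u) = Cexp u ^ n.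
Proof.
  induction n as [|n IH].
  - simpl. rewrite Cmult_0_l. apply Cexp_0.
  - rewrite Cpow_S, <- IH, <- Cexp_plus. f_equal. rewrite S_INR, RtoC_plus. ring.
Qed.

Lemma Cexp_Clog (z : C) : (0 < Re z)%R -> Cexp (Clog z) = z.
Proof.
  destruct z as [x y]. simpl. intros Hx.
  assert (Hm : (0 < Cmod (x, y))%R).
  { apply Cmod_gt_0. intros E. injection E. intros. simpl in *. lra. }
  unfold Cexp, Clog, Carg. simpl.
  destruct (Rlt_dec 0 x) as [_|]; [|contradiction].
  rewrite exp_ln by exact Hm. rewrite cos_atan, sin_atan.
  assert (E : (sqrt (1 + (y / x)²) = Cmod (x, y) / x)%R).
  { apply sqrt_lem_1.
    - assert (0 <= (y / x)²)%R by apply Rle_0_sqr. lra.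
    - left. now apply Rdiv_lt_0_compat.
    - unfold Cmod. simpl fst; simpl snd.
      replace (sqrt (x ^ 2 + y ^ 2) / x * (sqrt (x ^ 2 + y ^ 2) / x))%R
        with ((sqrt (x ^ 2 + y ^ 2) * sqrt (x ^ 2 + y ^ 2)) / (x * x))%R by (field; lra).
      rewrite sqrt_sqrt by nra. unfold Rsqr. field. lra. }
  rewrite E. f_equal; field; split; lra.
Qed.

Lemma Cexp_eq_1 (u : C) : Cexp u = 1 -> (Rabs (Im u) < 2 * PI)%R -> u = 0.
Proof.
  destruct u as [a b]. unfold Cexp. simpl. intros H Hb. injection H. intros Hs Hc.
  assert (P := PI_RGT_0). assert (E := exp_pos a).
  assert (S0 : sin b = 0%R).
  { apply Rmult_integral in Hs. destruct Hs; [lra|assumption]. }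
  assert (T := sin2_cos2 b). rewrite S0 in T. unfold Rsqr in T.
  assert (C1 : cos b = 1%R) by nra.
  assert (A0 : a = 0%R).
  { rewrite C1, Rmult_1_r in Hc. rewrite <- exp_0 in Hc. now apply exp_inv. }
  assert (B0 : b = 0%R).
  { apply Rabs_def2 in Hb. 
    (* cos b = 1 forces sin (b/2) = 0, and |b/2| < PI leaves only b = 0. *)
    assert (Hh : sin (b / 2) = 0%R).
    { replace b with (2 * (b / 2))%R in C1 by field. rewrite cos_2a_sin in C1. nra. }
    destruct (Rtotal_order b 0) as [L|[L|L]]; [|assumption|].
    - assert (0 < sin (- (b / 2)))%R by (apply sin_gt_0; lra).
      rewrite sin_neg in H0. lra.
    - assert (0 < sin (b / 2))%R by (apply sin_gt_0; lra). lra. }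
  now rewrite A0, B0.
Qed.

Lemma Im_Clog_lt (z : C) : (0 < Re z)%R -> (Rabs (Im (Clog z)) < PI / 2)%R.
Proof.
  intros H. unfold Clog, Carg. simpl.
  destruct (Rlt_dec 0 (Re z)) as [_|]; [|contradiction].
  apply Rabs_def1; destruct (atan_bound (Im z / Re z)); lra.
Qed.

Lemma Im_Clog_small (z : C) : (Rabs (Im z) < Re z)%R -> (Rabs (Im (Clog z)) < PI / 4)%R.
Proof.
  intros H. assert (0 < Re z)%R by (apply Rle_lt_trans with (2 := H); apply Rabs_pos).
  unfold Clog, Carg. simpl.
  destruct (Rlt_dec 0 (Re z)) as [_|]; [|contradiction].
  apply Rabs_def2 in H. rewrite <- atan_1.
  apply Rabs_def1.
  - apply atan_increasing. apply Rmult_lt_reg_r with (Re z); [assumption|].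
    unfold Rdiv. rewrite Rmult_assoc, Rinv_l; lra.
  - rewrite <- atan_opp. apply atan_increasing. apply Rmult_lt_reg_r with (Re z); [assumption|].
    unfold Rdiv. rewrite Rmult_assoc, Rinv_l; lra.
Qed.

(** As Re z > 0 confines Im (Clog z) to less than PI/2 in absolute value, u may reach 3 PI/2 before
    the two logarithms could differ by 2 PI. This margin lets [Y_point] combine logarithms. *)
Lemma Clog_Cexp (u z : C) :
  Cexp u = z -> (0 < Re z)%R -> (Rabs (Im u) < 3 * (PI / 2))%R -> Clog z = u.
Proof.
  intros E Hz Hu. assert (H := Cexp_Clog z Hz). assert (G := Im_Clog_lt z Hz).
  assert (D : Clog z - u = 0).
  { apply Cexp_eq_1.
    - unfold Cminus. rewrite Cexp_plus, Cexp_opp, H, E. field. rewrite <- E. apply Cexp_nz.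
    - replace (Im (Clog z - u)) with (Im (Clog z) - Im u)%R by reflexivity.
      apply Rabs_def2 in Hu. apply Rabs_def2 in G. apply Rabs_def1; lra. }
  replace (Clog z) with (Clog z - u + u) by ring. rewrite D. ring.
Qed.

(** Derivative along a real parameter, by components. The binomial series is studied on the segment
    s w with 0 <= s <= 1, so real calculus in one variable suffices. *)
Definition rderiv (f : R -> C) (s : R) (d : C) : Prop :=
  is_derive (fun x => Re (f x)) s (Re d) /\ is_derive (fun x => Im (f x)) s (Im d).

Lemma rderiv_mult (f g : R -> C) (s : R) (df dg : C) :
  rderiv f s df -> rderiv g s dg -> rderiv (fun x => f x * g x) s (df * g s + f s * dg).
Proof.
  intros [Hf1 Hf2] [Hg1 Hg2]. split.
  - unfold Cmult; simpl.
    evar_last. apply (is_derive_minus (V := R_NormedModule)).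
    apply (is_derive_mult (K := R_AbsRing)); [exact Hf1|exact Hg1|exact Rmult_comm].
    apply (is_derive_mult (K := R_AbsRing)); [exact Hf2|exact Hg2|exact Rmult_comm].
    unfold minus, plus, opp, mult, Re, Im; simpl. ring.
  - unfold Cmult; simpl.
    evar_last. apply (is_derive_plus (V := R_NormedModule)).
    apply (is_derive_mult (K := R_AbsRing)); [exact Hf1|exact Hg2|exact Rmult_comm].
    apply (is_derive_mult (K := R_AbsRing)); [exact Hf2|exact Hg1|exact Rmult_comm].
    unfold minus, plus, opp, mult, Re, Im; simpl. ring.
Qed.

Lemma rderiv_Cexp (f : R -> C) (s : R) (d : C) :
  rderiv f s d -> rderiv (fun x => Cexp (f x)) s (Cexp (f s) * d).
Proof.
  intros [H1 H2]. unfold rderiv, Cexp; simpl.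
  assert (E1 : is_derive (fun x => exp (Re (f x))) s (Re d * exp (Re (f s)))%R).
  { exact (is_derive_comp exp (fun x => Re (f x)) s _ _ (is_derive_exp _) H1). }
  assert (E2 : is_derive (fun x => cos (Im (f x))) s (Im d * - sin (Im (f s)))%R).
  { exact (is_derive_comp cos (fun x => Im (f x)) s _ _ (is_derive_cos _) H2). }
  assert (E3 : is_derive (fun x => sin (Im (f x))) s (Im d * cos (Im (f s)))%R).
  { exact (is_derive_comp sin (fun x => Im (f x)) s _ _ (is_derive_sin _) H2). }
  split.
  - evar_last. apply (is_derive_mult (K := R_AbsRing)); [exact E1|exact E2|exact Rmult_comm].
    unfold minus, plus, opp, mult, Re, Im; simpl. ring.
  - evar_last. apply (is_derive_mult (K := R_AbsRing)); [exact E1|exact E3|exact Rmult_comm].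
    unfold minus, plus, opp, mult, Re, Im; simpl. ring.
Qed.

Lemma rderiv_scal (c : C) (f : R -> C) (s : R) (d : C) :
  rderiv f s d -> rderiv (fun x => c * f x) s (c * d).
Proof.
  intros H. assert (K : rderiv (fun _ => c) s 0).
  { split; apply (is_derive_const (K := R_AbsRing) (V := R_NormedModule)). }
  assert (G := rderiv_mult _ _ _ _ _ K H).
  replace (c * d) with (0 * f s + c * d) by ring. exact G.
Qed.

Lemma rderiv_0_const (f : R -> C) :
  (forall s, (0 <= s <= 1)%R -> rderiv f s 0) -> f 0%R = f 1%R.
Proof.
  intros H.
  assert (E1 := eq_is_derive (V := R_NormedModule) (fun x => Re (f x)) 0 1
                  (fun s Hs => proj1 (H s Hs)) Rlt_0_1).
  assert (E2 := eq_is_derive (V := R_NormedModule) (fun x => Im (f x)) 0 1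
                  (fun s Hs => proj2 (H s Hs)) Rlt_0_1).
  simpl in *. destruct (f 0%R), (f 1%R). simpl in *. congruence.
Qed.

Lemma rderiv_Clog (w : C) (s : R) :
  (Cmod w < 1)%R -> (0 <= s <= 1)%R ->
  rderiv (fun x => Clog (1 + x * w)) s (w / (1 + s * w)).
Proof.
  intros Hw Hs. destruct w as [a b].
  assert (Ha : (Rabs a < 1)%R) by (apply Rle_lt_trans with (2 := Hw); apply (re_le_Cmod (a, b))).
  apply Rabs_def2 in Ha.
  assert (Hp : (0 < 1 + s * a)%R) by nra.
  assert (HRe : forall x : R, Re (1 + x * (a, b)) = (1 + x * a)%R) by (intros; simpl; ring).
  assert (HIm : forall x : R, Im (1 + x * (a, b)) = (x * b)%R) by (intros; simpl; ring).
  assert (Hn : (0 < (1 + s * a) ^ 2 + (s * b) ^ 2)%R) by nra.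
  assert (ERe : Re ((a, b) / (1 + s * (a, b)))
    = ((a + s * (a ^ 2 + b ^ 2)) / ((1 + s * a) ^ 2 + (s * b) ^ 2))%R).
  { unfold Cdiv, Cinv, Cmult, Cplus, RtoC, Re; simpl. field. nra. }
  assert (EIm : Im ((a, b) / (1 + s * (a, b)))
    = (b / ((1 + s * a) ^ 2 + (s * b) ^ 2))%R).
  { unfold Cdiv, Cinv, Cmult, Cplus, RtoC, Im; simpl. field. nra. }
  split.
  - apply (is_derive_ext (fun x => ln (sqrt ((1 + x * a) ^ 2 + (x * b) ^ 2)))).
    { intros x. unfold Clog, Cmod. simpl. f_equal. f_equal. ring. }
    rewrite ERe. auto_derive.
    + simpl in Hn. split; [lra|]. split; [|exact I]. apply sqrt_lt_R0. lra.
    + set (D := ((1 + s * a) ^ 2 + (s * b) ^ 2)%R) in *.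
      replace ((1 + s * a) * ((1 + s * a) * 1) + s * b * (s * b * 1))%R with D
        by (unfold D; ring).
      assert (HD := sqrt_sqrt D (Rlt_le _ _ Hn)).
      assert (0 < sqrt D)%R by (apply sqrt_lt_R0; exact Hn).
      transitivity ((a + s * (a ^ 2 + b ^ 2)) / (sqrt D * sqrt D))%R; [field; lra|].
      now rewrite HD.
  (* The equality is only local: [Carg] equals this arctangent where 1 + x a > 0, which holds in a
     neighbourhood of s. *)
  - apply (is_derive_ext_loc (fun x => atan (x * b / (1 + x * a)))).
    { assert (Hc : continuous (fun x => 1 + x * a)%R s).
      { apply (ex_derive_continuous (K := R_AbsRing) (V := R_NormedModule)). auto_derive. easy. }
      assert (Ho := Hc (fun y => 0 < y)%R (open_gt 0 _ Hp)).
      destruct Ho as [e Ho]. exists e. intros x Hx. specialize (Ho x Hx). cbn in Ho.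
      unfold Clog, Carg. cbn [Im snd]. rewrite HRe, HIm.
      destruct (Rlt_dec 0 (1 + x * a)); [reflexivity|contradiction]. }
    rewrite EIm. auto_derive; [lra|]. 
    unfold Rsqr. field. split; [nra|lra].
Qed.

Lemma INR_le_pow2 (n : nat) : (INR (S n) <= 2 ^ n)%R.
Proof.
  induction n as [|n IH]; [simpl; lra|].
  rewrite S_INR. assert (1 <= 2 ^ n)%R by (apply pow_R1_Rle; lra). simpl pow. lra.
Qed.

Lemma Re_scal_r (z : C) (s : R) : Re (z * s) = (Re z * s)%R.
Proof. destruct z. simpl. ring. Qed.

Lemma Im_scal_r (z : C) (s : R) : Im (z * s) = (Im z * s)%R.
Proof. destruct z. simpl. ring. Qed.


(* The bound in radius 4 keeps the closed unit interval inside the disk of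
   convergence, for the differentiated series as well. *)
Lemma rderiv_power_series (a : nat -> C) (K : R) :
  (forall n, (Cmod (a n) * 4 ^ n <= K)%R) ->
  exists phi d : R -> C,
    forall s, (0 <= s <= 1)%R ->
      cseries (fun n => a n * RtoC (s ^ n)%R) (phi s) /\
      cseries (fun n => (INR (S n) * a (S n)) * RtoC (s ^ n)%R) (d s) /\
      rderiv phi s (d s).
Proof.
  intros H.
  assert (HK : (0 <= K)%R).
  { specialize (H O). simpl in H. assert (G := Cmod_ge_0 (a O)). lra. }
  assert (P4 : forall n : nat, (0 < 4 ^ n)%R) by (intros; apply pow_lt; lra).
  assert (Hb : forall n : nat, (Cmod (a n) <= K * (1/4) ^ n)%R).
  { intros n. unfold Rdiv. rewrite Rmult_1_l, pow_inv.
    apply Rmult_le_reg_r with (4 ^ n)%R; [apply P4|].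
    rewrite Rmult_assoc, Rinv_l, Rmult_1_r; [apply H|]. apply Rgt_not_eq, P4. }
  set (p := fun n : nat => Re (a n)). set (q := fun n : nat => Im (a n)).
  exists (fun s => (PSeries p s, PSeries q s)),
    (fun s => (PSeries (PS_derive p) s, PSeries (PS_derive q) s)).
  assert (Hcv : forall r : nat -> R, (forall n, Rabs (r n) <= Cmod (a n))%R ->
     forall s, (0 <= s <= 1)%R -> Rbar_lt (Rabs s) (CV_radius r)).
  { intros r Hr s Hs. rewrite Rabs_pos_eq by lra.
    apply Rbar_lt_le_trans with 2%R; [simpl; lra|].
    apply (proj1 (CV_radius_bounded r)). exists K. intros n.
    rewrite Rabs_mult, (Rabs_pos_eq (2 ^ n)) by (apply pow_le; lra).
    apply Rle_trans with (Cmod (a n) * 4 ^ n)%R; [|apply H].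
    apply Rmult_le_compat; [apply Rabs_pos|apply pow_le; lra|apply Hr|].
    apply pow_incr; lra. }
  assert (Hpow : forall s, (0 <= s <= 1)%R -> forall n : nat, (0 <= s ^ n <= 1)%R).
  { intros s Hs n. split; [apply pow_le; lra|]. rewrite <- (pow1 n). apply pow_incr; lra. }
  assert (Cs : forall s : R, (0 <= s <= 1)%R -> forall n : nat, Cmod (RtoC (s ^ n)) = (s ^ n)%R).
  { intros s Hs n. rewrite Cmod_R. apply Rabs_pos_eq, Hpow, Hs. }
  intros s Hs. split; [|split].
  - destruct (cseries_geom_bound (fun n => a n * RtoC (s ^ n)%R) K (1/4)) as [L [HL _]].
    + lra.
    + intros n. rewrite Cmod_mult, Cs by exact Hs. specialize (Hpow s Hs n).
      apply Rle_trans with (Cmod (a n) * 1)%R; [|rewrite Rmult_1_r; apply Hb].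
      apply Rmult_le_compat_l; [apply Cmod_ge_0|lra].
    + apply (cseries_val _ _ _ HL). rewrite <- (CSeries_unique _ _ HL).
      unfold CSeries, PSeries. f_equal; apply Series_ext; intros n.
      * apply Re_scal_r.
      * apply Im_scal_r.
  - destruct (cseries_geom_bound (fun n => (INR (S n) * a (S n)) * RtoC (s ^ n)%R) K (1/2))
      as [L [HL _]].
    + lra.
    + intros n. rewrite !Cmod_mult, Cs, Cmod_INR by exact Hs. specialize (Hpow s Hs n).
      apply Rle_trans with (INR (S n) * Cmod (a (S n)) * 1)%R.
      { apply Rmult_le_compat_l; [|lra].
        apply Rmult_le_pos; [apply pos_INR|apply Cmod_ge_0]. }
      rewrite Rmult_1_r.
      apply Rle_trans with (2 ^ n * (K * (1/4) ^ S n))%R.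
      { apply Rmult_le_compat; [apply pos_INR|apply Cmod_ge_0|apply INR_le_pow2|apply Hb]. }
      replace (1 / 2)%R with (2 * (1 / 4))%R by field.
      rewrite Rpow_mult_distr. simpl pow.
      assert (0 <= 2 ^ n * (1 / 4) ^ n)%R by (apply Rmult_le_pos; apply pow_le; lra). nra.
    + apply (cseries_val _ _ _ HL). rewrite <- (CSeries_unique _ _ HL).
      unfold CSeries, PSeries, PS_derive. f_equal; apply Series_ext; intros n.
      * rewrite Re_scal_r. f_equal. unfold p. destruct (a (S n)). cbn. ring.
      * rewrite Im_scal_r. f_equal. unfold q. destruct (a (S n)). cbn. ring.
  - split; cbn [Re Im fst snd]; apply is_derive_PSeries; apply Hcv; auto.
    + intros n. apply re_le_Cmod.
    + intros n. apply im_le_Cmod.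
Qed.

Lemma INR_bound (x : R) : exists N : nat, (x <= INR N)%R.
Proof.
  destruct (INR_unbounded x) as [N HN]. exists N. lra.
Qed.

Lemma Cmod_add_1_pos (u : C) : (Cmod u < 1)%R -> (0 < Re (1 + u))%R.
Proof.
  intros H. assert (G := re_le_Cmod u). destruct u as [a b]. cbn in *.
  assert (Rabs a < 1)%R by lra. apply Rabs_def2 in H0. lra.
Qed.

(** The series phi(s) in powers of s w satisfies (1 + s w) phi' = c w phi. Hence phi(s) (1 + s
    w)^(-c) is constant on [0, 1], with value 1 at s = 0; evaluate at s = 1. *)
Theorem binomial_series (c w : C) :
  (Cmod w <= 1 / 8)%R -> cseries (fun n => binom c n * w ^ n) (Cexp (c * Clog (1 + w))).
Proof.
  intros Hw.
  destruct (INR_bound (Cmod c)) as [M HM].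
  set (a := fun n => binom c n * w ^ n).
  (* The coefficient is at most 2^M 2^n (1/8)^n, so the radius 1/8 is just enough for the weight
     4^n. *)
  assert (Ha : forall n, (Cmod (a n) * 4 ^ n <= 2 ^ M)%R).
  { intros n. unfold a. rewrite Cmod_mult, Cmod_pow.
    assert (Hbn := Cmod_binom_le c M n ltac:(lra)). rewrite pow_add in Hbn.
    assert (HMp : (0 < 2 ^ M)%R) by (apply pow_lt; lra).
    apply Rle_trans with (2 ^ M * 2 ^ n * (1/8) ^ n * 4 ^ n)%R.
    - apply Rmult_le_compat_r; [apply pow_le; lra|].
      apply Rmult_le_compat; [apply Cmod_ge_0|apply pow_le, Cmod_ge_0|exact Hbn|].
      apply pow_incr. split; [apply Cmod_ge_0|exact Hw].
    - rewrite !Rmult_assoc, <- !Rpow_mult_distr.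
      replace (2 * (1 / 8 * 4))%R with 1%R by field. rewrite pow1. lra. }
  destruct (rderiv_power_series a _ Ha) as [phi [d Hphi]].
  assert (Hsw : forall s, (0 <= s <= 1)%R -> (Cmod (s * w) < 1)%R).
  { intros s Hs. rewrite Cmod_mult, Cmod_R, Rabs_pos_eq by lra.
    assert (G := Cmod_ge_0 w). nra. }
  assert (Hnz : forall s, (0 <= s <= 1)%R -> 1 + s * w <> 0).
  { intros s Hs E. assert (G := Cmod_add_1_pos _ (Hsw s Hs)). rewrite E in G. cbn in G. lra. }
  assert (Hode : forall s, (0 <= s <= 1)%R -> (1 + s * w) * d s = c * w * phi s).
  { intros s Hs. destruct (Hphi s Hs) as [H1 [H2 _]].
    (* Multiplying phi' by s shifts the index; the term n = 0 vanishes. *)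
    assert (H3 : cseries (fun n => INR n * a n * RtoC (s ^ n)%R) (s * d s)).
    { apply (is_series_decr_1 (V := C_NormedModule)).
      assert (H4 := cseries_scal s _ _ H2).
      apply (cseries_ext (fun n => s * (INR (S n) * a (S n) * RtoC (s ^ n)%R))).
      { intros n. change (s ^ S n)%R with (s * s ^ n)%R. rewrite RtoC_mult. ring. }
      apply (cseries_val _ _ _ H4).
      change (s * d s = s * d s + - (INR 0 * a O * RtoC (s ^ 0)%R)). simpl. ring. }
    apply (cseries_unique (fun n => c * w * (a n * RtoC (s ^ n)%R)));
      [|apply cseries_scal, H1].
    (* Coefficientwise the equation is (n+1) binom(c, n+1) + n binom(c, n) = c binom(c, n). *)
    apply (cseries_ext (fun n => INR (S n) * a (S n) * RtoC (s ^ n)%R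
       + w * (INR n * a n * RtoC (s ^ n)%R))).
    { intros n. unfold a. rewrite Cpow_S.
      assert (G := binom_S c n). rewrite S_INR, RtoC_plus.
      transitivity (((INR n + 1) * binom c (S n) + INR n * binom c n) * w * w ^ n * RtoC (s ^ n)%R);
        [ring|]. rewrite G. ring. }
    apply (cseries_val _ (d s + w * (s * d s))); [|ring].
    apply cseries_plus; [exact H2|]. apply cseries_scal, H3. }
  set (psi := fun s : R => Cexp (- c * Clog (1 + s * w))).
  assert (Hconst : phi 0%R * psi 0%R = phi 1%R * psi 1%R).
  { apply (rderiv_0_const (fun s => phi s * psi s)). intros s Hs.
    destruct (Hphi s Hs) as [_ [_ H3]].
    assert (H4 := rderiv_Cexp _ _ _ (rderiv_scal (- c) _ _ _ (rderiv_Clog w s ltac:(lra) Hs))).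
    assert (H5 := rderiv_mult _ _ _ _ _ H3 H4).
    replace (RtoC 0) with (d s * Cexp (- c * Clog (1 + s * w)) +
      phi s * (Cexp (- c * Clog (1 + s * w)) * (- c * (w / (1 + s * w))))); [exact H5|].
    assert (N := Hnz s Hs). assert (O := Hode s Hs).
    replace (d s) with (c * w * phi s / (1 + s * w)) by (rewrite <- O; field; exact N).
    field. exact N. }
  assert (E0 : phi 0%R = 1).
  { destruct (Hphi 0%R ltac:(lra)) as [H1 _].
    apply (cseries_unique _ _ _ H1).
    apply (is_series_decr_1 (V := C_NormedModule)).
    apply (cseries_ext (fun n => 0 * (a (S n) * 0))).
    { intros n. rewrite pow_i by lia. ring. }
    destruct (cseries_geom_bound (fun n => 0) 0 0) as [L [HL _]]; [lra| |].
    { intros k. rewrite Cmod_0. lra. }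
    apply (cseries_val _ (0 * L)).
    { apply (cseries_ext (fun n => 0 * 0)); [intros; ring|]. apply cseries_scal, HL. }
    change (0 * L = 1 + - (a O * RtoC (0 ^ 0)%R)). unfold a. rewrite binom_0. simpl. ring. }
  assert (P0 : psi 0%R = 1).
  { unfold psi. replace (1 + 0%R * w) with (RtoC 1) by ring.
    replace (Clog 1) with (RtoC 0).
    - rewrite Cmult_0_r. apply Cexp_0.
    - symmetry. apply Clog_Cexp; [apply Cexp_0|simpl; lra|].
      simpl. rewrite Rabs_R0. assert (G := PI_RGT_0). lra. }
  assert (E1 : phi 1%R = Cexp (c * Clog (1 + w))).
  { rewrite E0, P0 in Hconst. unfold psi in Hconst.
    replace (1 + 1%R * w) with (1 + w) in Hconst by ring.
    replace (- c * Clog (1 + w)) with (- (c * Clog (1 + w))) in Hconst by ring.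
    rewrite Cexp_opp in Hconst.
    assert (G := Cexp_nz (c * Clog (1 + w))).
    replace (phi 1%R) with (phi 1%R * / Cexp (c * Clog (1 + w)) * Cexp (c * Clog (1 + w)))
      by (field; exact G).
    rewrite <- Hconst. ring. }
  destruct (Hphi 1%R ltac:(lra)) as [H1 _]. rewrite E1 in H1.
  apply (cseries_ext _ _ _ (fun n => eq_trans (f_equal (fun x => a n * RtoC x) (pow1 n)) (Cmult_1_r _)) H1).
Qed.

(** * Resummation near y = 1 *)

Definition geom_bounded (c : nat -> C) : Prop :=
  exists K M : R, (0 <= K)%R /\ (1 <= M)%R /\ forall k, (Cmod (c k) <= K * M ^ k)%R.

(** The initial terms are absorbed by adding their total modulus to the constant. Needed since for
    small k the Pochhammer index k + l - 1 may be negative and the factorial estimates do not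
    apply. *)
Lemma geom_bounded_eventually (c : nat -> C) (n0 : nat) (K M : R) :
  (forall k, (n0 <= k)%nat -> (Cmod (c k) <= K * M ^ k)%R) -> geom_bounded c.
Proof.
  intros H.
  assert (Hs : forall n k, (k <= n)%nat -> (Cmod (c k) <= sum_n (fun k => Cmod (c k)) n)%R).
  { induction n as [|n IH]; intros k Hk.
    - rewrite sum_O. replace k with O by lia. lra.
    - rewrite sum_Sn. unfold plus; simpl.
      assert (0 <= Cmod (c (S n)))%R by apply Cmod_ge_0.
      destruct (Nat.eq_dec k (S n)) as [->|].
      + assert (0 <= sum_n (fun k => Cmod (c k)) n)%R; [|lra].
        apply Rle_trans with (2 := IH n (le_n _)). apply Cmod_ge_0.
      + specialize (IH k ltac:(lia)). lra. }
  assert (Hp : (0 <= sum_n (fun k => Cmod (c k)) n0)%R).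
  { apply Rle_trans with (2 := Hs n0 n0 (le_n _)). apply Cmod_ge_0. }
  assert (HK := Rabs_pos K). assert (HM := Rabs_pos M).
  exists (Rabs K + sum_n (fun k => Cmod (c k)) n0)%R, (Rabs M + 1)%R.
  split; [lra|]. split; [lra|]. intros k.
  assert (H1 : (1 <= (Rabs M + 1) ^ k)%R) by (apply pow_R1_Rle; lra).
  destruct (le_lt_dec n0 k) as [L|L].
  - apply Rle_trans with (1 := H k L).
    apply Rle_trans with (Rabs K * (Rabs M + 1) ^ k)%R; [|nra].
    apply Rle_trans with (1 := Rle_abs _). rewrite Rabs_mult.
    apply Rmult_le_compat_l; [lra|]. rewrite <- RPow_abs.
    apply pow_incr. lra.
  - specialize (Hs n0 k ltac:(lia)). nra.
Qed.

Lemma geom_bounded_mult (c f : nat -> C) (n0 : nat) (B : R) :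
  geom_bounded c -> (forall k, (n0 <= k)%nat -> (Cmod (f k) <= B)%R) ->
  geom_bounded (fun k => c k * f k).
Proof.
  intros (K & M & HK & HM & H) Hf.
  apply (geom_bounded_eventually _ n0 (K * B) M). intros k Hk.
  rewrite Cmod_mult. replace (K * B * M ^ k)%R with (K * M ^ k * B)%R by ring.
  apply Rmult_le_compat; try apply Cmod_ge_0; auto.
Qed.

Lemma pow_mult_pow (a b : R) (M0 k : nat) : (a ^ (M0 * (k + 1)) = a ^ M0 * (a ^ M0) ^ k)%R.
Proof. rewrite Nat.mul_add_distr_l, Nat.mul_1_r, pow_add, pow_mult. ring. Qed.

Lemma Cmod_affine_le (A B : C) :
  exists M0 : nat, forall k : nat, (Cmod (A + B * INR k) <= INR (M0 * (k + 1)))%R.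
Proof.
  destruct (INR_bound (Cmod A + Cmod B)) as [M0 HM0]. exists M0. intros k.
  apply Rle_trans with (1 := Cmod_triangle _ _).
  rewrite Cmod_mult, Cmod_INR, mult_INR, plus_INR. simpl (INR 1).
  assert (0 <= Cmod A)%R by apply Cmod_ge_0. assert (0 <= Cmod B)%R by apply Cmod_ge_0.
  assert (0 <= INR k)%R by apply pos_INR. nra.
Qed.

Lemma Cpow_opp1_sq (k : nat) : (- (1)) ^ k * (- (1)) ^ k = RtoC 1.
Proof.
  rewrite <- Cpow_mult_l. replace (- (1) * - (1)) with (RtoC 1) by ring. apply Cpow_1_l.
Qed.

Definition resum (A B : C) (c : nat -> C) (r : nat) : C :=
  sum_n (fun k => (- (1)) ^ k * c k * binom (A + (B - 1) * INR k) (r - k)) r.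

(* Near [y = 1], with [w = (1 - y) / y] and [z = (y - 1) y^(-B)
   = - w (1 + w)^(B - 1)]: expand every power of [1 + w] in
   [y^(-A) * sum_k c_k z^k] by the binomial series and collect powers of [w]. *)
Theorem resummation (A B : C) (c : nat -> C) :
  geom_bounded c ->
  exists rho : R, (0 < rho)%R /\ (rho <= 1/8)%R /\ forall w : C, (Cmod w < rho)%R ->
    exists D : C, cseries (fun r => resum A B c r * w ^ r) D /\
      cseries (fun k => c k * (- w * Cexp ((B - 1) * Clog (1 + w))) ^ k)
        (Cexp (- A * Clog (1 + w)) * D).
Proof.
  intros (K & M & HK & HM & Hc).
  destruct (Cmod_affine_le A (B - 1)) as [M0 HM0].
  assert (HQ : (1 <= 2 ^ M0)%R) by (apply pow_R1_Rle; lra).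
  (* The term (k, s) is bounded by a constant times (Q |w|)^k (2 |w|)^s: c_k gives M^k, and the
     binomial with upper entry of size M0 (k+1) gives 2^(M0 (k+1)) 2^s. The radius 1/(8 Q) makes
     both ratios less than 1/2. *)
  set (Q := (M * 2 ^ M0)%R). assert (HQ1 : (1 <= Q)%R) by (unfold Q; nra).
  exists (/ (8 * Q))%R. split; [apply Rinv_0_lt_compat; lra|]. split.
  { apply Rle_trans with (/ 8)%R; [|lra]. apply Rinv_le_contravar; lra. }
  intros w Hw.
  assert (HwQ : (Cmod w * Q < 1/8)%R).
  { apply Rmult_lt_compat_r with (r := Q) in Hw; [|lra].
    replace (/ (8 * Q) * Q)%R with (1/8)%R in Hw by (field; lra). exact Hw. }
  assert (Hw0 := Cmod_ge_0 w). assert (Hw8 : (Cmod w <= 1/8)%R) by nra.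
  set (lam := Clog (1 + w)).
  set (e := fun k => A + (B - 1) * INR k).
  set (a := fun k s => (- (1)) ^ k * c k * binom (e k) s * w ^ (k + s)).
  destruct (cseries_antidiag a
     (fun k => (- (1)) ^ k * c k * w ^ k * Cexp (e k * lam)) (K * 2 ^ M0))
    as [L [HL1 HL2]].
  - intros k s. unfold a. rewrite !Cmod_mult, !Cmod_pow, Cmod_m1, pow1, Rmult_1_l.
    assert (Hb := Cmod_binom_le (e k) (M0 * (k + 1)) s
                    ltac:(unfold e; specialize (HM0 k); lra)).
    rewrite pow_add, (pow_mult_pow 2 2) in Hb.
    apply Rle_trans with
      ((K * M ^ k) * (2 ^ M0 * (2 ^ M0) ^ k * 2 ^ s) * Cmod w ^ (k + s))%R.
    + apply Rmult_le_compat_r; [now apply pow_le|].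
      apply Rmult_le_compat; auto using Cmod_ge_0.
    + rewrite !pow_add.
      replace (K * M ^ k * (2 ^ M0 * (2 ^ M0) ^ k * 2 ^ s) * (Cmod w ^ k * Cmod w ^ s))%R
        with (K * 2 ^ M0 * ((M * 2 ^ M0 * Cmod w) ^ k * (2 * Cmod w) ^ s))%R
        by (rewrite !Rpow_mult_distr; ring).
      apply Rmult_le_compat_l; [nra|].
      apply Rmult_le_compat; [apply pow_le; fold Q; nra|apply pow_le; lra| |].
      * apply pow_incr. fold Q. nra.
      * apply pow_incr. lra.
  - intros k. unfold a.
    apply (cseries_ext (fun s => (- (1)) ^ k * c k * w ^ k * (binom (e k) s * w ^ s))).
    { intros s. rewrite Cpow_add_r. ring. }
    apply cseries_scal, binomial_series, Hw8.
  - exists L. split.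
    + refine (cseries_ext _ _ _ _ HL2). intros r. unfold resum.
      rewrite (Cmult_comm _ (w ^ r)). 
      change (w ^ r * sum_n (fun k => (- (1)) ^ k * c k * binom (A + (B - 1) * INR k) (r - k)) r)
        with (mult (w ^ r : C_AbsRing) (sum_n (fun k => (- (1)) ^ k * c k * binom (A + (B - 1) * INR k) (r - k)) r)).
      rewrite <- (sum_n_mult_l (K := C_Ring)).
      apply csum_ext_le. intros k Hk. unfold a, e.
      replace (k + (r - k))%nat with r by lia.
      change ((- (1)) ^ k * c k * binom (A + (B - 1) * INR k) (r - k) * w ^ r =
        w ^ r * ((- (1)) ^ k * c k * binom (A + (B - 1) * INR k) (r - k))). ring.
    + refine (cseries_ext _ _ _ _ (cseries_scal (Cexp (- A * lam)) _ _ HL1)).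
      intros k. simpl. rewrite Cpow_mult_l, <- Cexp_INR.
      replace (- w) with (- (1) * w) by ring. rewrite Cpow_mult_l.
      transitivity (c k * ((- (1)) ^ k * w ^ k * (Cexp (- A * lam) * Cexp (e k * lam)))); [ring|].
      rewrite <- Cexp_plus. do 3 f_equal. unfold e. ring.
Qed.

(** * Coefficients of the expansion of F_l *)

Lemma pochZ_eq_poch (n : Z) (x : C) (k : nat) : n = Z.of_nat k -> pochZ x n = poch x k.
Proof. intros ->. apply pochZ_nat. Qed.

Lemma poch_fact (n k : nat) : poch (INR n + 1) k * INR (fact n) = INR (fact (n + k)).
Proof.
  induction k as [|k IH]; [rewrite Nat.add_0_r; simpl; ring|].
  simpl poch. rewrite Nat.add_succ_r, fact_simpl, mult_INR, RtoC_mult, <- IH.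
  rewrite S_INR, plus_INR, !RtoC_plus. ring.
Qed.

Lemma binom_fact (r k : nat) : (k <= r)%nat ->
  binom (INR r) k = INR (fact r) / (INR (fact k) * INR (fact (r - k))).
Proof.
  intros H. unfold binom.
  replace (RtoC (INR r) - INR k) with (RtoC (INR (r - k)))
    by (rewrite minus_INR by exact H; apply RtoC_minus).
  assert (E := poch_fact (r - k) k). replace (r - k + k)%nat with r in E by lia.
  rewrite <- E. field. split; apply INR_fact_C.
Qed.

(** Adjacent Pochhammer symbols concatenate: (x)_(r-k) (x+r-k)_(k+l-1) = (x)_(r+l-1) with x = A + B
    k - r + 1. This turns the convolution from the binomial expansions into an r-th finite
    difference in k. *)
Lemma binom_f_diag (l : Z) (A B : C) (k r : nat) : (k <= r)%nat ->
  pochZ_defined (A + B * INR k - INR k + 1) (Z.of_nat k + l - 1) ->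
  binom_f l A B k k * binom (A + (B - 1) * INR k) (r - k)
  = binom (INR r) k * binom_f l A B k r.
Proof.
  intros Hk Hd. unfold binom_f. rewrite binom_fact by exact Hk. unfold binom at 1.
  set (j := (r - k)%nat).
  assert (Ej : RtoC (INR r) = INR k + INR j).
  { unfold j. rewrite minus_INR, RtoC_minus by exact Hk. ring. }
  replace (A + B * INR k - INR k + 1) with (A + B * INR k - INR r + 1 + INR j) in *
    by (rewrite Ej; ring).
  destruct (pochZ_add _ _ _ Hd) as [_ E].
  replace (Z.of_nat j + (Z.of_nat k + l - 1))%Z with (Z.of_nat r + l - 1)%Z in E by (unfold j; lia).
  rewrite <- E.
  replace (A + (B - 1) * INR k - INR j + 1) with (A + B * INR k - INR r + 1)
    by (rewrite Ej; ring).
  unfold Cdiv. set (P := / pochZ (A + 1) (l - 1)).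
  field. repeat split; apply INR_fact_C.
Qed.

Lemma geom_bounded_binom_f (l : Z) (A B : C) : pochZ (A + 1) (l - 1) <> 0 ->
  geom_bounded (fun k => binom_f l A B k k).
Proof.
  intros HP. set (P := pochZ (A + 1) (l - 1)) in *.
  destruct (Cmod_affine_le (A + 1) (B - 1)) as [M0 HM0].
  set (j := Z.to_nat (Z.abs l)).
  (* For k > |l| = j the index k + l - 1 is a natural number n <= k + j. Both n!/(k! j!) and 2^n are
     at most 2^k 2^j, whence the 4 in the ratio and the two factors 2^j. *)
  apply (geom_bounded_eventually _ (S j)
    (INR (fact j) * 2 ^ j * 2 ^ j * 2 ^ M0 / Cmod P) (4 * 2 ^ M0)).
  intros k Hk. unfold binom_f. fold P.
  set (n := Z.to_nat (Z.of_nat k + l - 1)).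
  rewrite (pochZ_eq_poch _ _ n) by (unfold n; lia).
  rewrite !Cmod_div, Cmod_INR by (try exact HP; apply INR_fact_C).
  assert (HPp : (0 < Cmod P)%R) by (now apply Cmod_gt_0).
  assert (Hf := INR_fact_lt_0 k).
  assert (Hb := Cmod_poch_le (A + B * INR k - INR k + 1) (M0 * (k + 1)) n).
  replace (A + B * INR k - INR k + 1) with (A + 1 + (B - 1) * INR k) in * by ring.
  specialize (Hb ltac:(specialize (HM0 k); lra)).
  assert (Hn : (n <= k + j)%nat) by (unfold n, j; lia).
  assert (H1 : (INR (fact n) <= INR (fact k) * INR (fact j) * 2 ^ (k + j))%R).
  { apply Rle_trans with (2 := fact_plus_le k j). apply le_INR, fact_le, Hn. }
  rewrite pow_add, (pow_mult_pow 2 2) in Hb.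
  assert (H2 : (2 ^ n <= 2 ^ (k + j))%R) by (apply Rle_pow; [lra|exact Hn]).
  assert (Hp2 : forall i : nat, (0 < 2 ^ i)%R) by (intros; apply pow_lt; lra).
  apply Rmult_le_reg_r with (Cmod P * INR (fact k))%R; [now apply Rmult_lt_0_compat|].
  replace (Cmod (poch (A + 1 + (B - 1) * INR k) n) / INR (fact k) / Cmod P *
     (Cmod P * INR (fact k)))%R with (Cmod (poch (A + 1 + (B - 1) * INR k) n)) by (field; lra).
  apply Rle_trans with (1 := Hb).
  rewrite pow_add in H1, H2.
  replace (INR (fact j) * 2 ^ j * 2 ^ j * 2 ^ M0 / Cmod P * (4 * 2 ^ M0) ^ k *
     (Cmod P * INR (fact k)))%R
    with ((INR (fact k) * INR (fact j) * (2 ^ k * 2 ^ j)) *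
          ((2 ^ M0 * (2 ^ M0) ^ k) * (2 ^ k * 2 ^ j)))%R.
  - apply Rmult_le_compat.
    + left. apply INR_fact_lt_0.
    + left. apply Rmult_lt_0_compat; [apply Rmult_lt_0_compat|]; auto.
      apply pow_lt, Hp2.
    + exact H1.
    + apply Rmult_le_compat_l; [|exact H2].
      left. apply Rmult_lt_0_compat; auto. apply pow_lt, Hp2.
  - replace 4%R with (2 * 2)%R by ring. rewrite !Rpow_mult_distr. field. lra.
Qed.

Lemma add_1_nz (w : C) : (Cmod w < 1)%R -> 1 + w <> 0.
Proof. intros H E. assert (G := Cmod_add_1_pos w H). rewrite E in G. simpl in G. lra. Qed.

Theorem F_series (l : Z) (A B : C) : F_defined l A B ->
  exists rho : R, (0 < rho)%R /\ forall w : C, (Cmod w < rho)%R ->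
    cseries (fun k => binom_f l A B k k * (- w * Cexp ((B - 1) * Clog (1 + w))) ^ k)
      (Cexp (- A * Clog (1 + w)) * F_ l A B (/ (1 + w))).
Proof.
  intros (_ & HP & Hd).
  destruct (resummation A B _ (geom_bounded_binom_f l A B HP)) as (rho & Hrho & Hle & H).
  exists rho. split; [exact Hrho|]. intros w Hw.
  destruct (H w Hw) as (D & HD & HS). apply (cseries_val _ _ _ HS). f_equal.
  symmetry. apply CSeries_unique. refine (cseries_ext _ _ _ _ HD). intros r.
  assert (N : 1 + w <> 0) by (apply add_1_nz; lra).
  replace ((1 - / (1 + w)) / / (1 + w)) with w by (field; exact N).
  f_equal. unfold resum, fhat. apply csum_ext_le. intros k Hk.
  transitivity ((- (1)) ^ k * (binom_f l A B k k * binom (A + (B - 1) * INR k) (r - k))); [cring|].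
  rewrite binom_f_diag by (auto with arith). cring.
Qed.

(** * Finite differences and the functions G_0, G_1 *)

(** Equal to (-1)^r times the r-th forward difference of g at 0. *)
Definition altsum (r : nat) (g : nat -> C) : C :=
  sum_n (fun k => (- (1)) ^ k * binom (INR r) k * g k) r.

Lemma INR_S_C (n : nat) : RtoC (INR (S n)) = INR n + 1.
Proof. now rewrite S_INR, RtoC_plus. Qed.

Lemma INR_S_nz (n : nat) : RtoC (INR n) + 1 <> 0.
Proof.
  rewrite <- INR_S_C. intros E. apply RtoC_inj in E. exact (not_0_INR (S n) (Nat.neq_succ_0 n) E).
Qed.

Lemma binom_absorb (c : C) (k : nat) : (INR k + 1) * binom (c + 1) (S k) = (c + 1) * binom c k.
Proof.
  unfold binom.
  replace (c + 1 - INR (S k) + 1) with (c - INR k + 1) by (rewrite INR_S_C; ring).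
  simpl poch. replace (c - INR k + 1 + INR k) with (c + 1) by ring.
  rewrite fact_simpl, mult_INR, RtoC_mult, INR_S_C.
  field. split; [apply INR_fact_C|apply INR_S_nz].
Qed.

Lemma binom_pascal (c : C) (k : nat) : binom (c + 1) (S k) = binom c (S k) + binom c k.
Proof.
  assert (N := INR_S_nz k).
  assert (E : (INR k + 1) * binom (c + 1) (S k) = (INR k + 1) * (binom c (S k) + binom c k)).
  { rewrite binom_absorb, Cmult_plus_distr_l, binom_S. ring. }
  replace (binom (c + 1) (S k)) with ((INR k + 1) * binom (c + 1) (S k) / (INR k + 1))
    by (field; exact N).
  rewrite E. field. exact N.
Qed.

Lemma binom_gt (r : nat) : binom (INR r) (S r) = 0.
Proof.
  assert (N := INR_S_nz r). assert (E := binom_S (INR r) r).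
  replace (binom (INR r) (S r)) with ((INR r + 1) * binom (INR r) (S r) / (INR r + 1))
    by (field; exact N).
  rewrite E. field. exact N.
Qed.

Lemma csum_plus (u v : nat -> C) (n : nat) :
  sum_n (fun k => u k + v k) n = sum_n u n + sum_n v n.
Proof. exact (sum_n_plus (G := C_AbelianGroup) u v n). Qed.

Lemma csum_scal (c : C) (u : nat -> C) (n : nat) :
  sum_n (fun k => c * u k) n = c * sum_n u n.
Proof. exact (sum_n_mult_l (K := C_Ring) c u n). Qed.

Lemma altsum_ext (r : nat) (g h : nat -> C) :
  (forall k, g k = h k) -> altsum r g = altsum r h.
Proof. intros H. apply csum_ext_le. intros k _. now rewrite H. Qed.

Lemma altsum_plus (r : nat) (g h : nat -> C) :
  altsum r (fun k => g k + h k) = altsum r g + altsum r h.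
Proof.
  unfold altsum. rewrite <- csum_plus. apply csum_ext_le. intros k _. cring.
Qed.

Lemma altsum_scal (r : nat) (c : C) (g : nat -> C) :
  altsum r (fun k => c * g k) = c * altsum r g.
Proof.
  unfold altsum. rewrite <- csum_scal. apply csum_ext_le. intros k _. cring.
Qed.

Lemma altsum_S (r : nat) (g : nat -> C) :
  altsum (S r) g = altsum r g - altsum r (fun k => g (S k)).
Proof.
  unfold altsum. rewrite csum_shift.
  (* The first sum is extended by its vanishing term k = r + 1; after splitting off k = 0, Pascal's
     rule applies termwise. *)
  transitivity (sum_n (fun k => (- (1)) ^ k * binom (INR r) k * g k) (S r) -
    sum_n (fun k => (- (1)) ^ k * binom (INR r) k * g (S k)) r).
  - rewrite csum_shift, !binom_0. unfold Cminus. rewrite <- Cplus_assoc. f_equal.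
    replace (- sum_n (fun k => (- (1)) ^ k * binom (INR r) k * g (S k)) r)
      with (- (1) * sum_n (fun k => (- (1)) ^ k * binom (INR r) k * g (S k)) r) by cring.
    rewrite <- csum_scal, <- csum_plus. apply csum_ext_le. intros k _.
    rewrite INR_S_C, binom_pascal, !Cpow_S. cring.
  - rewrite csum_S, binom_gt. cring.
Qed.

(** From k binom(r+1, k) = (r+1) binom(r, k-1): a factor k lowers the order of the difference by
    one. *)
Lemma altsum_mul_index (r : nat) (g : nat -> C) :
  altsum (S r) (fun k => INR k * g k) = - (INR r + 1) * altsum r (fun k => g (S k)).
Proof.
  unfold altsum. rewrite csum_shift, <- csum_scal.
  simpl (INR 0). rewrite Cmult_0_l, Cmult_0_r, Cplus_0_l.
  apply csum_ext_le. intros k _. rewrite !INR_S_C, Cpow_S.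
  transitivity (- (- (1)) ^ k * g (S k) * ((INR k + 1) * binom (INR r + 1) (S k))); [cring|].
  rewrite binom_absorb. cring.
Qed.

(** Monic polynomials given by their roots: up to a power of B, Pochhammer symbols of e + B x have
    this form, and the class is stable under x -> x + 1. *)
Definition linprod (al : list C) (x : C) : C := fold_right (fun a p => (x - a) * p) 1 al.

Lemma linprod_shift (al : list C) (x : C) :
  linprod al (x + 1) = linprod (map (fun a => a - 1) al) x.
Proof. induction al as [|a al IH]; simpl; [reflexivity|]. rewrite IH. ring. Qed.

(** The r-th difference annihilates degree below r and sends a monic polynomial of degree r to a
    factorial. Peel off x - a: the factor x lowers the order by one, and the part with a has degree
    below the order. *)
Lemma altsum_linprod (n : nat) : forall (r : nat) (al : list C),
  length al = n -> (n <= r)%nat ->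
  altsum r (fun k => linprod al (INR k)) = if Nat.eqb n r then (- (1)) ^ r * INR (fact r) else 0.
Proof.
  induction n as [|n IH]; intros r al Hl Hr.
  - destruct al; [|discriminate]. destruct r as [|r].
    + unfold altsum. rewrite sum_O, binom_0. simpl. cring.
    + rewrite altsum_S. simpl. cring.
  - destruct al as [|a al]; [discriminate|]. injection Hl as Hl.
    destruct r as [|r]; [lia|].
    rewrite (altsum_ext _ _ (fun k => INR k * linprod al (INR k) + - a * linprod al (INR k)))
      by (intros; simpl; ring).
    rewrite altsum_plus, altsum_scal, altsum_mul_index.
    rewrite (IH (S r) al Hl) by lia.
    replace (Nat.eqb n (S r)) with false by (symmetry; apply Nat.eqb_neq; lia).
    rewrite (altsum_ext _ _ (fun k => linprod (map (fun a => a - 1) al) (INR k)))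
      by (intros; now rewrite INR_S_C, linprod_shift).
    rewrite (IH r) by (rewrite ?length_map; lia).
    simpl (Nat.eqb (S n) (S r)). destruct (Nat.eqb n r); [|cring].
    rewrite fact_simpl, mult_INR, RtoC_mult, INR_S_C, Cpow_S. cring.
Qed.

Lemma poch_nz (x : C) (n : nat) : (forall k : nat, x + INR k <> 0) -> poch x n <> 0.
Proof.
  intros H. induction n as [|n IH]; [exact C1_nz|]. simpl. now apply Cmult_neq_0.
Qed.

(** This is the partial fraction expansion of r! / (x (x+1) ... (x+r)); the induction subtracts the
    formula at x + 1 from the one at x. *)
Lemma altsum_inv (r : nat) : forall x : C, (forall k : nat, x + INR k <> 0) ->
  altsum r (fun k => / (x + INR k)) = INR (fact r) / poch x (S r).
Proof.
  induction r as [|r IH]; intros x Hx.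
  - unfold altsum. rewrite sum_O, binom_0. simpl. assert (H := Hx O). simpl in H. field.
    assert (E : x + 0 = x) by ring. rewrite E in H. auto.
  - rewrite altsum_S, IH by exact Hx.
    rewrite (altsum_ext _ _ (fun k => / (x + 1 + INR k))).
    2:{ intros k. rewrite INR_S_C. f_equal. ring. }
    assert (Hx1 : forall k : nat, x + 1 + INR k <> 0).
    { intros k. specialize (Hx (S k)). rewrite INR_S_C in Hx.
      intros E. apply Hx. rewrite <- E. ring. }
    rewrite IH by exact Hx1.
    rewrite (poch_S_l x (S r)). rewrite (poch_S_l x r).
    change (poch (x + 1) (S r)) with (poch (x + 1) r * (x + 1 + INR r)).
    assert (H1 := Hx O). assert (H2 := Hx1 r). assert (H3 := poch_nz (x + 1) r Hx1).
    assert (H4 : x <> 0) by (intros E; apply H1; rewrite E; simpl; ring).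
    rewrite fact_simpl, mult_INR, RtoC_mult, INR_S_C. field. auto.
Qed.

(** Dividing P(k) by k + x leaves the remainder P(-x). The quotient has degree below r and is
    annihilated, so only the pole contributes. *)
Lemma altsum_linprod_div (r : nat) (x : C) (al : list C) :
  (forall k : nat, x + INR k <> 0) -> (length al <= r)%nat ->
  altsum r (fun k => linprod al (INR k) / (x + INR k))
  = linprod al (- x) * INR (fact r) / poch x (S r).
Proof.
  intros Hx. induction al as [|a al IH]; intros Hl.
  - rewrite (altsum_ext _ _ (fun k => / (x + INR k))).
    2:{ intros k. simpl. field. apply Hx. }
    rewrite altsum_inv by exact Hx. simpl linprod. unfold Cdiv. ring.
  - simpl in Hl.
    rewrite (altsum_ext _ _ (fun k => linprod al (INR k) + (- x - a) * (linprod al (INR k) / (x + INR k)))).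
    2:{ intros k. simpl. field. apply Hx. }
    rewrite altsum_plus, altsum_scal, IH by lia.
    rewrite (altsum_linprod (length al)) by (reflexivity || lia).
    replace (Nat.eqb (length al) r) with false by (symmetry; apply Nat.eqb_neq; lia).
    simpl linprod. unfold Cdiv. ring.
Qed.

(** One degree higher the quotient is monic of degree r and survives as (-1)^r r!. This is the
    source of the extra factor in G_1. *)
Lemma altsum_linprod_div_S (r : nat) (x : C) (al : list C) :
  (forall k : nat, x + INR k <> 0) -> length al = S r ->
  altsum r (fun k => linprod al (INR k) / (x + INR k))
  = linprod al (- x) * INR (fact r) / poch x (S r) + (- (1)) ^ r * INR (fact r).
Proof.
  intros Hx Hl. destruct al as [|a al]; [discriminate|]. injection Hl as Hl.
  rewrite (altsum_ext _ _ (fun k => linprod al (INR k) + (- x - a) * (linprod al (INR k) / (x + INR k)))).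
  2:{ intros k. simpl. field. apply Hx. }
  rewrite altsum_plus, altsum_scal, altsum_linprod_div by (exact Hx || lia).
  rewrite (altsum_linprod r) by (exact Hl || lia). rewrite Nat.eqb_refl.
  simpl linprod. unfold Cdiv. ring.
Qed.

(** * Evaluation of the expansions of G_0 and G_1 *)

Lemma poch_linprod (B e : C) (r : nat) : B <> 0 ->
  exists al : list C, length al = r /\ forall x, poch (e + B * x) r = B ^ r * linprod al x.
Proof.
  intros HB. induction r as [|r (al & Hl & H)].
  - exists nil. split; [reflexivity|]. intros x. simpl. ring.
  - exists (- (e + INR r) / B :: al). split; [simpl; now rewrite Hl|].
    intros x. simpl. rewrite H. field. exact HB.
Qed.

Lemma poch_nz_of_S (x : C) : x <> 0 -> (forall n : nat, x + 1 <> - INR n) ->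
  forall k : nat, x + INR k <> 0.
Proof.
  intros H0 H [|k] E.
  - apply H0. rewrite <- E. simpl. ring.
  - apply (H k). rewrite INR_S_C in E. 
    replace (x + 1) with (x + (INR k + 1) - INR k) by ring. rewrite E. ring.
Qed.

(* The factor [x / (x + k)] is what the parameter pair [p; p + 1] of the 4F3
   contributes: [(p)_m / (p + 1)_m = p / (p + m)]. *)
Definition G_coef (l : Z) (A B D : C) (k : nat) : C :=
  let x := (A + D + IZR l) / B in binom_f (l + 1) A B k k * (x / (x + INR k)).

Lemma eventually_inv_bound (x : C) : exists n0 : nat, forall k, (n0 <= k)%nat ->
  (Cmod (x / (x + INR k)) <= Cmod x)%R.
Proof.
  destruct (INR_bound (Cmod x + 1)) as [n0 Hn0]. exists n0. intros k Hk.
  apply le_INR in Hk.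
  assert (H : (1 <= Cmod (x + INR k))%R).
  { assert (G := Cmod_triangle (x + INR k) (- x)).
    replace (x + INR k + - x) with (RtoC (INR k)) in G by ring.
    rewrite Cmod_INR, Cmod_opp in G. lra. }
  assert (N : x + INR k <> 0) by (intros E; rewrite E, Cmod_0 in H; lra).
  rewrite Cmod_div by exact N. assert (P := Cmod_ge_0 x).
  apply Rmult_le_reg_r with (Cmod (x + INR k)); [lra|].
  unfold Rdiv. rewrite Rmult_assoc, Rinv_l by lra. nra.
Qed.

Lemma resum_G_coef (l : Z) (A B D : C) (r : nat) : l = 0%Z \/ l = 1%Z ->
  let x := (A + D + IZR l) / B in
  resum A B (G_coef l A B D) r
  = altsum r (fun k => x * (binom_f (l + 1) A B k r / (x + INR k))).
Proof.
  intros Hl x. unfold resum, altsum. apply csum_ext_le. intros k Hk.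
  unfold G_coef. fold x.
  transitivity ((- (1)) ^ k * (binom_f (l + 1) A B k k * binom (A + (B - 1) * INR k) (r - k))
    * (x / (x + INR k))); [cring|].
  rewrite binom_f_diag; [unfold Cdiv; cring|exact Hk|].
  (* For l = 0 or 1 the index k + l is nonnegative, so no reciprocal occurs. *)
  destruct (Z.of_nat k + (l + 1) - 1)%Z eqn:E; [exact I|exact I|lia].
Qed.

(** At the pole k = -x one has A + B k = -D, and the numerator becomes (-D-r+1)_r = (-1)^r (D)_r: so
    D turns into an upper parameter. The denominator (x)_(r+1) loses its first factor to the x in
    [G_coef]. *)
Lemma resum_G_coef_0 (A B D : C) (r : nat) :
  B <> 0 -> A + D <> 0 -> lower_ok (G0_lower A B D) ->
  resum A B (G_coef 0 A B D) r = (- (1)) ^ r * poch D r / poch ((A + D) / B + 1) r.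
Proof.
  intros HB HAD Hlow. rewrite resum_G_coef by auto.
  set (x := (A + D + IZR 0) / B).
  assert (Ex : (A + D) / B = x) by (unfold x; f_equal; ring).
  assert (Hx0 : x <> 0).
  { intros E. apply HAD. replace (A + D) with (B * x) by (unfold x; field; exact HB).
    rewrite E. ring. }
  rewrite Ex. assert (Hx : forall k : nat, x + INR k <> 0).
  { apply poch_nz_of_S; [exact Hx0|]. apply Hlow. unfold G0_lower. rewrite Ex. left. reflexivity. }
  destruct (poch_linprod B (A - INR r + 1) r HB) as (al & Hal & Hp).
  rewrite (altsum_ext _ _ (fun k => x * B ^ r / INR (fact r) * (linprod al (INR k) / (x + INR k)))).
  2:{ intros k. unfold binom_f. change (0 + 1 - 1)%Z with 0%Z.
      rewrite (pochZ_eq_poch _ _ r) by lia. simpl pochZ.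
      replace (A + B * INR k - INR r + 1) with (A - INR r + 1 + B * INR k) by ring.
      rewrite Hp. field. split; [apply Hx|apply INR_fact_C]. }
  rewrite altsum_scal, altsum_linprod_div by (exact Hx || lia).
  assert (E := Hp (- x)).
  replace (A - INR r + 1 + B * - x) with (- D - INR r + 1) in E by (unfold x; field; exact HB).
  rewrite poch_reflect in E. replace (- - D) with D in E by ring.
  rewrite E, poch_S_l.
  assert (Hn : poch (x + 1) r <> 0).
  { apply poch_nz. intros k. specialize (Hx (S k)). rewrite INR_S_C in Hx.
    intros E'. apply Hx. rewrite <- E'. ring. }
  field. split; [exact Hn|]. split; [exact Hx0|]. apply INR_fact_C.
Qed.

(** Now the numerator has degree r + 1 in k. Besides the pole term, where A + B k = -D - 1, its
    leading coefficient B^(r+1) contributes. *)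
Lemma resum_G_coef_1 (A B D : C) (r : nat) :
  B <> 0 -> A + D + 1 <> 0 -> A + 1 <> 0 -> lower_ok (G1_lower A B D) ->
  let x := (A + D + 1) / B in
  resum A B (G_coef 1 A B D) r =
    (- (1)) ^ r * (x * B ^ S r - poch D (S r) / poch (x + 1) r) / (A + 1).
Proof.
  intros HB HAD HA Hlow x. rewrite resum_G_coef by auto.
  change (A + D + IZR 1) with (A + D + 1). fold x.
  assert (Hx0 : x <> 0).
  { intros E. apply HAD. replace (A + D + 1) with (B * x) by (unfold x; field; exact HB).
    rewrite E. ring. }
  assert (Hx : forall k : nat, x + INR k <> 0).
  { apply poch_nz_of_S; [exact Hx0|]. apply Hlow. left. reflexivity. }
  destruct (poch_linprod B (A - INR r + 1) (S r) HB) as (al & Hal & Hp).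
  rewrite (altsum_ext _ _ (fun k => x * B ^ S r / INR (fact r) / (A + 1) * (linprod al (INR k) / (x + INR k)))).
  2:{ intros k. unfold binom_f. change (1 + 1 - 1)%Z with 1%Z.
      rewrite (pochZ_eq_poch _ _ (S r)) by lia.
      replace (pochZ (A + 1) 1) with (A + 1) by (change (A + 1 = 1 * (A + 1 + 0)); ring).
      replace (A + B * INR k - INR r + 1) with (A - INR r + 1 + B * INR k) by ring.
      rewrite Hp. field. auto using INR_fact_C. }
  rewrite altsum_scal, altsum_linprod_div_S by (exact Hx || lia).
  assert (E := Hp (- x)).
  replace (A - INR r + 1 + B * - x) with (- D - INR (S r) + 1) in E
    by (rewrite INR_S_C; unfold x; field; exact HB).
  rewrite poch_reflect in E. replace (- - D) with D in E by ring.
  rewrite (poch_S_l x).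
  assert (Hn : poch (x + 1) r <> 0).
  { apply poch_nz. intros k. specialize (Hx (S k)). rewrite INR_S_C in Hx.
    intros E'. apply Hx. rewrite <- E'. ring. }
  assert (Hf := INR_fact_C r).
  transitivity (x / (A + 1) * ((B ^ S r * linprod al (- x)) / (x * poch (x + 1) r)
     + B ^ S r * (- (1)) ^ r)).
  { field. auto. }
  rewrite <- E, (Cpow_S (- (1))). field. auto.
Qed.

(** The combination is the coefficient of w^(r+1) in (1 + B w) times the series. It cancels the part
    x (-1)^r B^(r+1), which is geometric with ratio -B. The two pole terms merge into one, whose
    factor (v+r+1)/v is (v+1)_(r+1)/(v)_(r+1), the parameter pair of [G1]. *)
Lemma resum_G_coef_1_step (A B D : C) (r : nat) :
  B <> 0 -> B <> 1 -> A + D + 1 <> 0 -> A + 1 <> 0 -> lower_ok (G1_lower A B D) ->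
  let x := (A + D + 1) / B in
  let v := (A + 1) / (B - 1) in
  resum A B (G_coef 1 A B D) (S r) + B * resum A B (G_coef 1 A B D) r =
    (- (1)) ^ S r * (poch D (S r) * (v + INR (S r)) / (v * poch (x + 1) (S r))).
Proof.
  intros HB HB1 HAD HA Hlow x v. rewrite !resum_G_coef_1 by assumption. fold x.
  assert (HB1' : B - 1 <> 0).
  { intros E. apply HB1. replace B with (B - 1 + 1) by ring. rewrite E. ring. }
  assert (Hx1 : forall k : nat, x + 1 + INR k <> 0).
  { intros k E. apply (Hlow (x + 1) (or_introl eq_refl) k).
    replace (x + 1) with (x + 1 + INR k - INR k) by ring. rewrite E. ring. }
  assert (Hn := poch_nz _ r Hx1). assert (Hr := Hx1 r).
  change (poch D (S (S r))) with (poch D (S r) * (D + INR (S r))).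
  change (poch (x + 1) (S r)) with (poch (x + 1) r * (x + 1 + INR r)).
  rewrite !Cpow_S, INR_S_C.
  replace D with (B * x - A - 1) at 2 by (unfold x; field; exact HB).
  unfold v. field. auto.
Qed.

Theorem G_series (l : Z) (A B D : C) : l = 0%Z \/ l = 1%Z ->
  B <> 0 -> B <> 1 -> A + D + IZR l <> 0 -> pochZ (A + 1) l <> 0 ->
  lower_ok (G_lower l A B D) ->
  exists rho : R, (0 < rho)%R /\ forall w : C, (Cmod w < rho)%R ->
    cseries (fun k => G_coef l A B D k * (- w * Cexp ((B - 1) * Clog (1 + w))) ^ k)
      (Cexp (- A * Clog (1 + w)) * G_ l A B D (/ (1 + w))).
Proof.
  intros Hl HB HB1 HAD HA Hlow.
  set (x := (A + D + IZR l) / B).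
  destruct (eventually_inv_bound x) as [n0 Hn0].
  assert (Hg : geom_bounded (G_coef l A B D)).
  { unfold G_coef. fold x.
    apply (geom_bounded_mult _ _ n0 (Cmod x)); [|exact Hn0].
    apply geom_bounded_binom_f. replace (l + 1 - 1)%Z with l by lia. exact HA. }
  destruct (resummation A B _ Hg) as (rho & Hrho & Hle & H).
  assert (HB0 := Cmod_ge_0 B).
  (* The second bound ensures |B w| < 1, so that 1 + B w is invertible for G_1. *)
  exists (Rmin rho (/ (Cmod B + 1))). split.
  { apply Rmin_glb_lt; [exact Hrho|apply Rinv_0_lt_compat; lra]. }
  intros w Hw0.
  assert (Hw := Rlt_le_trans _ _ _ Hw0 (Rmin_l _ _)).
  assert (Hw' := Rlt_le_trans _ _ _ Hw0 (Rmin_r _ _)).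
  destruct (H w Hw) as (S & HD & HS). apply (cseries_val _ _ _ HS). f_equal.
  assert (N : 1 + w <> 0) by (apply add_1_nz; lra).
  assert (Ew : (/ (1 + w) - 1) / / (1 + w) = - w) by (field; exact N).
  destruct Hl as [-> | ->]; unfold G_; cbn [Z.eqb].
  - symmetry. unfold G0, pFq. rewrite Ew. apply CSeries_unique.
    refine (cseries_ext _ _ _ _ HD). intros r.
    rewrite resum_G_coef_0; [|exact HB| |exact Hlow].
    2:{ intros E. apply HAD. rewrite E. ring. }
    replace (- w) with (- (1) * w) by ring. rewrite Cpow_mult_l.
    unfold poch_prod, G0_lower. cbn [map fold_right].
    assert (H1 : poch 1 r <> 0).
    { apply poch_nz. intros k E. apply (INR_S_nz k). rewrite <- E. ring. }
    assert (H2 : poch ((A + D) / B + 1) r <> 0).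
    { apply poch_nz. intros k E. apply (Hlow _ (or_introl eq_refl) k).
      replace ((A + D) / B + 1) with ((A + D) / B + 1 + INR k - INR k) by ring.
      rewrite E. ring. }
    set (p := poch ((A + D) / B + 1) r) in *. field. auto.
  - assert (HB1' : B - 1 <> 0).
    { intros E. apply HB1. replace B with (B - 1 + 1) by ring. rewrite E. ring. }
    assert (HA1 : A + 1 <> 0).
    { intros E. apply HA. change (1 * (A + 1 + 0) = 0). rewrite E. ring. }
    change (IZR 1) with 1%R in *.
    assert (N2 : 1 + B * w <> 0).
    { apply add_1_nz. rewrite Cmod_mult.
      apply Rmult_lt_compat_r with (r := (Cmod B + 1)%R) in Hw'; [|lra].
      rewrite Rinv_l in Hw' by lra. assert (G := Cmod_ge_0 w). nra. }
    unfold G1. rewrite Ew.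
    replace (/ (1 + w) / ((1 - B) * / (1 + w) + B)) with (/ (1 + B * w)).
    2:{ field. repeat split; try exact N; try exact N2.
        intros E. apply N2. rewrite <- E. ring. }
    assert (HP : pFq (D :: (A + 1) / (B - 1) + 1 :: RtoC 1 :: nil) (G1_lower A B D) (- w)
                 = (1 + B * w) * S).
    { apply CSeries_unique.
      set (d := resum A B (G_coef 1 A B D)) in *.
      (* The coefficients of (1 + B w) times the resummed series; d 0 has no predecessor. *)
      set (e := fun r => match r with O => d O | Datatypes.S r' => d r + B * d r' end).
      apply (cseries_ext (fun r => e r * w ^ r)).
      { intros r.
        set (v := (A + 1) / (B - 1)).
        assert (Hv : forall k : nat, v + INR k <> 0).
        { intros k E. apply (Hlow v (or_intror (or_introl eq_refl)) k).
          replace v with (v + INR k - INR k) by ring. rewrite E. ring. }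
        assert (Hx1 : forall k : nat, x + 1 + INR k <> 0).
        { intros k E. apply (Hlow (x + 1) (or_introl eq_refl) k).
          replace (x + 1) with (x + 1 + INR k - INR k) by ring. rewrite E. ring. }
        assert (H1 : poch 1 r <> 0).
        { apply poch_nz. intros k E. apply (INR_S_nz k). rewrite <- E. ring. }
        assert (Hv0 : v <> 0).
        { intros E. apply (Hv O). rewrite E. simpl. ring. }
        assert (H2 := poch_nz _ r Hv). assert (H3 := poch_nz _ r Hx1).
        assert (Ee : e r = (- (1)) ^ r * (poch D r * (v + INR r) / (v * poch (x + 1) r))).
        { destruct r as [|r].
          - unfold e, d. rewrite resum_G_coef_1 by assumption.
            simpl. field. auto.
          - unfold e, d. now apply resum_G_coef_1_step. }
        rewrite Ee. replace (- w) with (- (1) * w) by ring. rewrite Cpow_mult_l.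
        unfold poch_prod, G1_lower. cbn [map fold_right]. fold x v.
        assert (Ep : poch (v + 1) r = poch v r * (v + INR r) / v).
        { change (poch v r * (v + INR r)) with (poch v (Datatypes.S r)).
          rewrite poch_S_l. field. exact Hv0. }
        change ((A + D + 1) / B) with x. rewrite Ep.
        field. auto. }
      replace ((1 + B * w) * S) with (S + B * w * S) by ring.
      assert (HS2 : cseries (fun r => match r with O => RtoC 0 | Datatypes.S r' => B * d r' * w ^ r end)
                      (B * w * S)).
      { apply (is_series_decr_1 (V := C_NormedModule)).
        apply (cseries_ext (fun r => B * w * (d r * w ^ r))).
        { intros r. rewrite Cpow_S. ring. }
        apply (cseries_val _ (B * w * S)); [apply cseries_scal, HD|].
        change (B * w * S = B * w * S + - 0). ring. }
      refine (cseries_ext _ _ _ _ (cseries_plus _ _ _ _ HD HS2)).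
      intros [|r]; unfold e; ring. }
    rewrite HP. field. exact N2.
Qed.

(** * The points Y_j and trisection *)

Lemma omega_cube : omega ^ 3 = 1.
Proof.
  unfold omega. rewrite <- Cexp_INR.
  replace (INR 3 * (2 * PI * Ci / 3)) with (2 * PI * Ci).
  - unfold Cexp. cbn. 
    replace (((2 * PI - 0 * 0) * 0 - (2 * 0 + 0 * PI) * 1))%R with 0%R by ring.
    replace (((2 * PI - 0 * 0) * 1 + (2 * 0 + 0 * PI) * 0))%R with (2 * PI)%R by ring.
    rewrite exp_0, cos_2PI, sin_2PI. unfold RtoC. f_equal; ring.
  - replace (RtoC (INR 3)) with (RtoC 3) by (f_equal; simpl; ring). field.
Qed.

Lemma omega_neq_1 : omega <> 1.
Proof.
  intros E. assert (P := PI_RGT_0).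
  assert (EI : 2 * PI * Ci / 3 = (0, 2 * PI / 3)%R).
  { unfold Cdiv. rewrite <- RtoC_inv by lra.
    unfold Cmult, Ci, RtoC. cbn. f_equal; field. }
  apply Cexp_eq_1 in E.
  - rewrite EI in E. injection E. lra.
  - rewrite EI. simpl. rewrite Rabs_pos_eq; lra.
Qed.

Lemma omega_sum : 1 + omega + omega ^ 2 = 0.
Proof.
  assert (E : (omega - 1) * (1 + omega + omega ^ 2) = 0).
  { transitivity (omega ^ 3 - 1); [ring|]. rewrite omega_cube. ring. }
  destruct (Ceq_dec (1 + omega + omega ^ 2) 0) as [H|H]; [exact H|].
  exfalso. apply omega_neq_1.
  destruct (Ceq_dec (omega - 1) 0) as [G|G].
  - replace omega with (omega - 1 + 1) by ring. rewrite G. ring.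
  - exfalso. exact (Cmult_neq_0 _ _ G H E).
Qed.

(** A partial sum ending at index 3 m + 2 consists of full blocks of three, each with at most one
    nonzero term, so it equals the m-th partial sum of the subsequence. *)
Lemma cseries_subseq_3 (v : nat -> C) (j : nat) (L : C) : (j <= 2)%nat ->
  (forall m i, (i <= 2)%nat -> i <> j -> v (3 * m + i)%nat = 0) ->
  cseries v L -> cseries (fun m => v (3 * m + j)%nat) L.
Proof.
  intros Hj Hv HL.
  assert (E : forall m, sum_n v (3 * m + 2) = sum_n (fun m => v (3 * m + j)%nat) m).
  { assert (E3 : forall m, v (3 * m)%nat + v (3 * m + 1)%nat + v (3 * m + 2)%nat = v (3 * m + j)%nat).
    { intros m. assert (H0 := Hv m 0%nat). assert (H1 := Hv m 1%nat). assert (H2 := Hv m 2%nat).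
      rewrite Nat.add_0_r in H0.
      destruct j as [|[|[|j]]]; [| | |lia]; rewrite ?Nat.add_0_r.
      - rewrite H1, H2 by lia. ring.
      - rewrite H0, H2 by lia. ring.
      - rewrite H0, H1 by lia. ring. }
    induction m as [|m IH].
    - rewrite sum_O, <- E3. simpl (3 * 0 + 2)%nat. rewrite !csum_S, sum_O. reflexivity.
    - rewrite csum_S, <- IH, <- E3.
      replace (3 * S m + 2)%nat with (S (S (S (3 * m + 2)))) by lia.
      rewrite !csum_S.
      replace (S (3 * m + 2)) with (3 * S m)%nat by lia.
      replace (S (3 * S m)) with (3 * S m + 1)%nat by lia.
      replace (S (3 * S m + 1)) with (3 * S m + 2)%nat by lia. cring. }
  rewrite cseries_eps in *. intros eps He. destruct (HL eps He) as [N HN].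
  exists N. intros n Hn. rewrite <- E. apply HN. lia.
Qed.

(** Orthogonality of the characters of Z/3: 1 + omega^(k-kappa) + omega^(2(k-kappa)) is 3 if k =
    kappa mod 3 and 0 otherwise. *)
Lemma trisection (c : nat -> C) (z S0 S1 S2 : C) (kappa : nat) : (kappa <= 2)%nat ->
  cseries (fun k => c k * z ^ k) S0 ->
  cseries (fun k => c k * (omega * z) ^ k) S1 ->
  cseries (fun k => c k * (omegabar * z) ^ k) S2 ->
  cseries (fun m => c (3 * m + kappa)%nat * z ^ (3 * m + kappa))
    (1 / 3 * (S0 + omegabar ^ kappa * S1 + omega ^ kappa * S2)).
Proof.
  intros Hk H0 H1 H2.
  set (v := fun k => c k * z ^ k *
     (1 / 3 * (1 + omegabar ^ kappa * omega ^ k + omega ^ kappa * omegabar ^ k))).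
  assert (Hv : cseries v (1 / 3 * (S0 + omegabar ^ kappa * S1 + omega ^ kappa * S2))).
  { refine (cseries_ext _ _ _ _ (cseries_scal (1 / 3) _ _ (cseries_plus _ _ _ _
      (cseries_plus _ _ _ _ H0 (cseries_scal (omegabar ^ kappa) _ _ H1))
      (cseries_scal (omega ^ kappa) _ _ H2)))).
    intros k. unfold v. simpl. rewrite !Cpow_mult_l. ring. }
  assert (Ew : forall m, omega ^ (3 * m) = 1).
  { intros m. rewrite Cpow_mult_r, omega_cube. apply Cpow_1_l. }
  assert (Eb : forall m, omegabar ^ (3 * m) = 1).
  { intros m. unfold omegabar. rewrite <- Cpow_mult_r.
    replace (2 * (3 * m))%nat with (3 * (2 * m))%nat by lia. apply Ew. }
  assert (Hd : forall i, (i <= 2)%nat ->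
    1 + omegabar ^ kappa * omega ^ i + omega ^ kappa * omegabar ^ i
    = if Nat.eqb i kappa then RtoC 3 else 0).
  { assert (H3 := omega_cube). assert (Hs := omega_sum).
    assert (H3' : omega * omega * omega = 1) by (rewrite <- H3; ring).
    intros i Hi. unfold omegabar.
    destruct i as [|[|[|i]]]; [| | |lia]; destruct kappa as [|[|[|kappa]]]; try lia; simpl Nat.eqb; cbv iota.
    - simpl; ring.
    - rewrite <- Hs; ring.
    - transitivity (1 + omega * omega * omega * omega + omega ^ 2); [ring|]. rewrite H3', <- Hs. ring.
    - rewrite <- Hs; ring.
    - transitivity (1 + omega * omega * omega + omega * omega * omega); [ring|]. rewrite H3'. ring.
    - transitivity (1 + (omega * omega * omega) * omega ^ 2 + omega * omega * omega * omega); [ring|].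
      rewrite H3', <- Hs. ring.
    - transitivity (1 + omega ^ 2 + omega * omega * omega * omega); [ring|]. rewrite H3', <- Hs. ring.
    - transitivity (1 + omega * omega * omega * omega + (omega * omega * omega) * omega ^ 2); [ring|].
      rewrite H3', <- Hs. ring.
    - transitivity (1 + (omega * omega * omega) * (omega * omega * omega)
        + (omega * omega * omega) * (omega * omega * omega)); [ring|]. rewrite H3'. ring. }
  assert (Hvi : forall m i, (i <= 2)%nat ->
     v (3 * m + i)%nat = c (3 * m + i)%nat * z ^ (3 * m + i) *
       (1 / 3 * (if Nat.eqb i kappa then RtoC 3 else 0))).
  { intros m i Hi. unfold v. rewrite <- (Hd i Hi), (Cpow_add_r omega), (Cpow_add_r omegabar), Ew, Eb. ring. }
  refine (cseries_ext _ _ _ _ (cseries_subseq_3 v kappa _ Hk _ Hv)).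
  - intros m. rewrite Hvi, Nat.eqb_refl by exact Hk. field.
  - intros m i Hi Hne. rewrite Hvi by exact Hi.
    replace (Nat.eqb i kappa) with false by (symmetry; now apply Nat.eqb_neq). ring.
Qed.

Lemma Re_inv_pos (u : C) : (0 < Re u)%R -> (0 < Re (/ u))%R.
Proof.
  destruct u as [x y]. cbn. intros H. apply Rdiv_lt_0_compat; nra.
Qed.

Lemma Im_Clog_add_1 (u : C) : (Cmod u <= 1/8)%R -> (Rabs (Im (Clog (1 + u))) < PI / 4)%R.
Proof.
  intros H. apply Im_Clog_small.
  assert (H1 := re_le_Cmod u). assert (H2 := im_le_Cmod u). destruct u as [x y]. cbn in *.
  assert (Hx : (Rabs x <= 1/8)%R) by lra. assert (Hy : (Rabs y <= 1/8)%R) by lra.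
  apply Rabs_le_between in Hx. replace (0 + y)%R with y by ring. lra.
Qed.

Lemma Im_minus (u v : C) : Im (u - v) = (Im u - Im v)%R.
Proof. reflexivity. Qed.

(* The point [y = Y tau] of the curve [z = (y - 1) y^(-1/3)] lies over
   [z = 3 tau (1 + tau^3)^(-2/3)]; here [y = 1 / (1 + w)]. *)
Lemma Y_point (a tau : C) : (Cmod tau <= 1/8)%R ->
  exists w, (Cmod w <= 7 * Cmod tau)%R /\
    / (1 + w) = (1 + tau) ^ 3 / (1 + tau ^ 3) /\
    Cexp (- - a * Clog (1 + w)) = Cpower ((1 + tau) ^ 3 / (1 + tau ^ 3)) (- a) /\
    - w * Cexp ((1 / 3 - 1) * Clog (1 + w)) = 3 * tau / Cpower (1 + tau ^ 3) (2 / 3).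
Proof.
  intros Ht. assert (Ht0 := Cmod_ge_0 tau).
  assert (Ht3 : (Cmod (tau ^ 3) <= 1/8)%R).
  { rewrite Cmod_pow. apply Rle_trans with ((1/8) ^ 3)%R; [apply pow_incr; lra|lra]. }
  assert (N1 : 1 + tau <> 0) by (apply add_1_nz; lra).
  assert (N3 : 1 + tau ^ 3 <> 0) by (apply add_1_nz; lra).
  assert (P1 := Cmod_add_1_pos tau ltac:(lra)).
  assert (P3 := Cmod_add_1_pos (tau ^ 3) ltac:(lra)).
  set (L1 := Clog (1 + tau)). set (L3 := Clog (1 + tau ^ 3)).
  assert (E1 : Cexp L1 = 1 + tau) by (apply Cexp_Clog, P1).
  assert (E3 : Cexp L3 = 1 + tau ^ 3) by (apply Cexp_Clog, P3).
  assert (E13 : Cexp (3 * L1) = (1 + tau) ^ 3).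
  { replace (RtoC 3) with (RtoC (INR 3)) by (f_equal; simpl; ring).
    now rewrite Cexp_INR, E1. }
  (* Forced by 1 + w = (1 + tau^3)/(1 + tau)^3, because 1 - tau + tau^2 = (1 + tau)^2 - 3 tau. *)
  set (w := - (3) * tau / (1 + tau) ^ 2).
  assert (N12 : (1 + tau) ^ 2 <> 0) by (apply Cpow_nz, N1).
  assert (Ew : 1 + w = (1 + tau ^ 3) / (1 + tau) ^ 3) by (unfold w; field; exact N1).
  assert (Hw : (Cmod w <= 7 * Cmod tau)%R).
  { unfold w. rewrite Cmod_div, Cmod_mult, Cmod_opp, Cmod_pow, Cmod_R, Rabs_pos_eq
      by (lra || exact N12).
    assert (G : (7/8 <= Cmod (1 + tau))%R).
    { assert (T := Cmod_triangle (1 + tau) (- tau)).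
      replace (1 + tau + - tau) with (RtoC 1) in T by ring.
      rewrite Cmod_1, Cmod_opp in T. lra. }
    assert (G2 : (49/64 <= Cmod (1 + tau) ^ 2)%R) by nra.
    apply Rmult_le_reg_r with (Cmod (1 + tau) ^ 2)%R; [lra|].
    unfold Rdiv. rewrite Rmult_assoc, Rinv_l by lra. nra. }
  assert (Pw := Cmod_add_1_pos w ltac:(lra)).
  assert (I1 := Im_Clog_add_1 tau Ht). assert (I3 := Im_Clog_add_1 (tau ^ 3) Ht3).
  fold L1 in I1. fold L3 in I3.
  assert (PP := PI_RGT_0).
  assert (I31 : Im (3 * L1) = (3 * Im L1)%R) by (destruct L1; simpl; ring).
  apply Rabs_def2 in I1, I3.
  (* Both arguments are below PI/4, so L3 - 3 L1 has imaginary part below PI in absolute value,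
     within the range of [Clog_Cexp]. *)
  assert (Lw : Clog (1 + w) = L3 - 3 * L1).
  { apply Clog_Cexp; [|exact Pw|].
    - unfold Cminus. rewrite Cexp_plus, Cexp_opp, E13, E3. now symmetry.
    - rewrite Im_minus, I31. apply Rabs_def1; lra. }
  assert (EY : / (1 + w) = (1 + tau) ^ 3 / (1 + tau ^ 3)).
  { rewrite Ew. field. split; [exact N3|exact N1]. }
  assert (LY : Clog ((1 + tau) ^ 3 / (1 + tau ^ 3)) = 3 * L1 - L3).
  { apply Clog_Cexp.
    - unfold Cminus. now rewrite Cexp_plus, Cexp_opp, E13, E3.
    - rewrite <- EY. apply Re_inv_pos, Pw.
    - rewrite Im_minus, I31. apply Rabs_def1; lra. }
  exists w. split; [exact Hw|]. split; [exact EY|]. split.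
  - unfold Cpower. rewrite Lw, LY. f_equal. ring.
  - unfold Cpower. fold L3. rewrite Lw.
    (* The part 2 L1 gives (1 + tau)^2, which cancels the denominator of w. *)
    replace ((1 / 3 - 1) * (L3 - 3 * L1)) with (INR 2 * L1 + - (2 / 3 * L3)).
    2:{ replace (RtoC (INR 2)) with (RtoC 2) by (f_equal; simpl; ring). field. }
    rewrite Cexp_plus, Cexp_INR, Cexp_opp, E1. unfold w.
    assert (N := Cexp_nz (2 / 3 * L3)). field. split; [exact N|exact N1].
Qed.

Lemma Cpower_cube (z : C) : (0 < Re z)%R -> Cpower z (2 / 3) ^ 3 = z ^ 2.
Proof.
  intros H. unfold Cpower. rewrite <- Cexp_INR.
  replace (INR 3 * (2 / 3 * Clog z)) with (INR 2 * Clog z).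
  - rewrite Cexp_INR. now rewrite Cexp_Clog.
  - replace (RtoC (INR 3)) with (RtoC 3) by (f_equal; simpl; ring).
    replace (RtoC (INR 2)) with (RtoC 2) by (f_equal; simpl; ring). field.
Qed.

Lemma Cmod_omega : Cmod omega = 1%R.
Proof.
  assert (E : (Cmod omega ^ 3 = 1)%R) by (rewrite <- Cmod_pow, omega_cube; apply Cmod_1).
  assert (G := Cmod_ge_0 omega). nra.
Qed.

(** [H] stands for F_l or G_l, so both identities share this step. The root of zeta_{1,2} is exactly
    1/z, hence the prefactor absorbs z^kappa and leaves a series in z^3. *)
Theorem trisected_series (a : C) (c : nat -> C) (H : C -> C) (kappa : nat) :
  (kappa <= 2)%nat ->
  (exists rho : R, (0 < rho)%R /\ forall w : C, (Cmod w < rho)%R ->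
    cseries (fun k => c k * (- w * Cexp ((1 / 3 - 1) * Clog (1 + w))) ^ k)
      (Cexp (- - a * Clog (1 + w)) * H (/ (1 + w)))) ->
  exists delta : R, (0 < delta)%R /\ forall t : C, (0 < Cmod t < delta)%R ->
    cseries (fun m => c (3 * m + kappa)%nat * (27 / 4) ^ m * (/ zeta12 t) ^ m)
      (zeta12_root t ^ kappa * (1 / 3 *
        (Cpower (Y0 t) (- a) * H (Y0 t)
         + omegabar ^ kappa * (Cpower (Y1 t) (- a) * H (Y1 t))
         + omega ^ kappa * (Cpower (Y2 t) (- a) * H (Y2 t))))).
Proof.
  intros Hk (rho & Hrho & HS).
  exists (Rmin (1/8) (rho / 7)). split; [apply Rmin_glb_lt; lra|].
  intros t [Ht0 Ht].
  assert (Ht1 := Rlt_le_trans _ _ _ Ht (Rmin_l _ _)).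
  assert (Ht2 := Rlt_le_trans _ _ _ Ht (Rmin_r _ _)).
  assert (Nt : t <> 0) by (now apply Cmod_gt_0).
  assert (Ht3 : (Cmod (t ^ 3) < 1)%R).
  { rewrite Cmod_pow. apply Rle_lt_trans with ((1/8) ^ 3)%R; [apply pow_incr; lra|lra]. }
  assert (N3 : 1 + t ^ 3 <> 0) by (apply add_1_nz, Ht3).
  assert (P3 := Cmod_add_1_pos _ Ht3).
  set (z := 3 * t / Cpower (1 + t ^ 3) (2 / 3)).
  assert (NP : Cpower (1 + t ^ 3) (2 / 3) <> 0) by (apply Cexp_nz).
  (* Replacing t by u t keeps t^3, hence the principal power in z, and multiplies z by u. *)
  assert (Key : forall u, u ^ 3 = 1 -> Cmod u = 1%R ->
    cseries (fun k => c k * (u * z) ^ k)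
      (Cpower ((1 + u * t) ^ 3 / (1 + t ^ 3)) (- a) * H ((1 + u * t) ^ 3 / (1 + t ^ 3)))).
  { intros u Hu Hu1.
    assert (Hut : Cmod (u * t) = Cmod t) by (rewrite Cmod_mult, Hu1; ring).
    assert (Eut : (u * t) ^ 3 = t ^ 3) by (rewrite Cpow_mult_l, Hu; ring).
    destruct (Y_point a (u * t)) as (w & Hw & EY & Ep & Ez); [lra|].
    rewrite Hut in Hw. specialize (HS w ltac:(lra)).
    rewrite Ez, EY, Ep, Eut in HS.
    refine (cseries_ext _ _ _ _ HS). intros k. cbv beta. do 2 f_equal. unfold z. field. exact NP. }
  assert (Mb : Cmod omegabar = 1%R).
  { unfold omegabar. rewrite Cmod_pow, Cmod_omega. ring. }
  assert (Eb : omegabar ^ 3 = 1).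
  { unfold omegabar. rewrite <- Cpow_mult_r. change (2 * 3)%nat with (3 * 2)%nat.
    rewrite Cpow_mult_r, omega_cube. apply Cpow_1_l. }
  assert (K0 := Key 1 ltac:(apply Cpow_1_l) Cmod_1).
  assert (K1 := Key omega omega_cube Cmod_omega).
  assert (K2 := Key omegabar Eb Mb). clear Key.
  fold (Y1 t) in K1. fold (Y2 t) in K2. rewrite !Cmult_1_l in K0. fold (Y0 t) in K0.
  assert (T := trisection c z _ _ _ kappa Hk K0 K1 K2).
  refine (cseries_ext _ _ _ _ (cseries_scal (zeta12_root t ^ kappa) _ _ T)).
  intros m. cbv beta.
  assert (Er : zeta12_root t * z = 1) by (unfold zeta12_root, z; field; auto).
  assert (Ez : z ^ 3 = 27 / 4 * / zeta12 t).
  { transitivity (27 * t ^ 3 / Cpower (1 + t ^ 3) (2 / 3) ^ 3); [unfold z; field; exact NP|].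
    rewrite Cpower_cube by exact P3. unfold zeta12. field. auto. }
  rewrite Cpow_add_r, Cpow_mult_r, Ez, Cpow_mult_l.
  transitivity (c (3 * m + kappa)%nat * (27 / 4) ^ m * (/ zeta12 t) ^ m * (zeta12_root t * z) ^ kappa).
  - rewrite Cpow_mult_l. ring.
  - rewrite Er, Cpow_1_l. ring.
Qed.

(** * Coefficients of the hypergeometric series *)

Lemma pochZ_succ (x : C) (n : Z) : pochZ_defined x n ->
  pochZ x (n + 1) = pochZ x n * (x + IZR n).
Proof.
  intros H. destruct (Z_le_gt_dec 0 n) as [Hn|Hn].
  - rewrite <- (Z2Nat.id n Hn). set (r := Z.to_nat n).
    replace (Z.of_nat r + 1)%Z with (Z.of_nat (S r)) by lia.
    rewrite !pochZ_nat, <- INR_IZR_INZ. reflexivity.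
  - set (s := Z.to_nat (- n - 1)).
    assert (E : n = (- Z.of_nat (S s))%Z) by (unfold s; lia).
    rewrite E in *. clear E Hn. clearbody s.
    replace (- Z.of_nat (S s) + 1)%Z with (- Z.of_nat s)%Z by lia.
    apply pochZ_defined_opp in H. rewrite !pochZ_opp.
    rewrite poch_S_l in *. rewrite opp_IZR, <- INR_IZR_INZ, RtoC_opp.
    replace (x - INR (S s) + 1) with (x - INR s) in * by (rewrite INR_S_C; ring).
    assert (N1 : x - INR (S s) <> 0) by (intros K; apply H; rewrite K; ring).
    assert (N2 : poch (x - INR s) s <> 0) by (intros K; apply H; rewrite K; ring).
    field. auto.
Qed.

(** As 3 (1/3 - 1) = -2, the step from k to k + 3 lowers the base x by 2 and raises the index by 3:
    two new factors in front and one at the end. They become the three upper parameters. *)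
Lemma binom_f_step3 (l : Z) (A : C) (k : nat) :
  let x := A + 1 / 3 * INR k - INR k + 1 in
  pochZ_defined x (Z.of_nat k + l - 1) ->
  binom_f l A (1 / 3) (k + 3) (k + 3) * ((INR k + 1) * (INR k + 2) * (INR k + 3))
  = binom_f l A (1 / 3) k k * ((x - 2) * (x - 1) * (x + INR k + IZR l - 1)).
Proof.
  intros x Hd. unfold binom_f. fold x.
  set (n := (Z.of_nat k + l - 1)%Z) in *.
  assert (E3 : RtoC (INR (k + 3)) = INR k + 3).
  { rewrite plus_INR, RtoC_plus. do 2 f_equal. simpl. ring. }
  replace (A + 1 / 3 * INR (k + 3) - INR (k + 3) + 1) with (x - 2)
    by (rewrite E3; unfold x; field).
  assert (Hd2 : pochZ_defined (x - 1 + 1) n) by (now replace (x - 1 + 1) with x by ring).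
  destruct (pochZ_step _ _ Hd2) as [Hd1 H1].
  assert (Hd3 : pochZ_defined (x - 2 + 1) (n + 1)) by (now replace (x - 2 + 1) with (x - 1) by ring).
  destruct (pochZ_step _ _ Hd3) as [Hd0 H0].
  replace (x - 1 + 1) with x in H1 by ring. replace (x - 2 + 1) with (x - 1) in H0 by ring.
  replace (Z.of_nat (k + 3) + l - 1)%Z with (n + 1 + 1 + 1)%Z by (unfold n; lia).
  rewrite (pochZ_succ (x - 2)) by exact Hd0. rewrite <- H0, <- H1.
  assert (En : x - 2 + IZR (n + 1 + 1) = x + INR k + IZR l - 1).
  { unfold n. rewrite INR_IZR_INZ, !plus_IZR, minus_IZR, !RtoC_plus, !plus_IZR, !RtoC_minus, RtoC_plus.
    ring. }
  rewrite En.
  assert (Ef : RtoC (INR (fact (k + 3))) =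
    INR (fact k) * ((INR k + 1) * (INR k + 2) * (INR k + 3))).
  { replace (k + 3)%nat with (S (S (S k))) by lia.
    rewrite !fact_simpl, !mult_INR, !RtoC_mult, !INR_S_C. ring. }
  rewrite Ef.
  assert (N1 := INR_S_nz k). assert (N2 := INR_S_nz (S k)). assert (N3 := INR_S_nz (S (S k))).
  rewrite !INR_S_C in N2. rewrite !INR_S_C in N3. assert (Nf := INR_fact_C k).
  replace (INR k + 1 + 1) with (INR k + 2) in * by ring.
  replace (INR k + 2 + 1) with (INR k + 3) in * by ring.
  unfold Cdiv. generalize (/ pochZ (A + 1) (l - 1)). intros P.
  field. auto.
Qed.

(** For n >= 0 the reciprocal of (1-x)_(-n) has the factors of (x)_n negated and in reverse order.
    Negative n is the same fact with x and 1 - x exchanged. *)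
Lemma pochZ_reflect (x : C) (n : Z) :
  pochZ_defined x n -> pochZ_defined (1 - x) (- n) ->
  pochZ x n * pochZ (1 - x) (- n) = if Z.even n then 1 else - (1).
Proof.
  assert (Hsg : forall r : nat, (- (1)) ^ r = if Z.even (Z.of_nat r) then 1 else - (1)).
  { induction r as [|r IH]; [reflexivity|].
    rewrite Nat2Z.inj_succ, Z.even_succ, <- Z.negb_even, Cpow_S, IH.
    destruct (Z.even (Z.of_nat r)); simpl; ring. }
  assert (Hnat : forall (y : C) (r : nat), poch (1 - y - INR r) r <> 0 ->
     poch y r * / poch (1 - y - INR r) r = (- (1)) ^ r).
  { intros y r. replace (1 - y - INR r) with (- y - INR r + 1) by ring.
    rewrite poch_reflect. replace (- - y) with y by ring. intros N.
    assert (N1 : (- (1)) ^ r <> 0) by (intros E; apply N; rewrite E; ring).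
    assert (N2 : poch y r <> 0) by (intros E; apply N; rewrite E; ring).
    assert (Hs := Cpow_opp1_sq r). revert N1 Hs. generalize ((- (1)) ^ r). intros s N1 Hs.
    transitivity (s * s / s); [rewrite Hs; field; auto|field; exact N1]. }
  intros H1 H2. destruct (Z_le_gt_dec 0 n) as [Hn|Hn].
  - rewrite <- (Z2Nat.id n Hn) in *. set (r := Z.to_nat n) in *.
    apply pochZ_defined_opp in H2.
    rewrite pochZ_nat, pochZ_opp, <- Hsg. now apply Hnat.
  - set (s := Z.to_nat (- n)).
    assert (E : n = (- Z.of_nat s)%Z) by (unfold s; lia).
    rewrite E in *. rewrite Z.opp_involutive in *.
    apply pochZ_defined_opp in H1.
    rewrite pochZ_nat, pochZ_opp, Z.even_opp, <- Hsg, Cmult_comm.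
    replace (x - INR s) with (1 - (1 - x) - INR s) in * by ring.
    now apply Hnat.
Qed.

(** Explains the constant of the theorem: it is the reciprocal of the first retained coefficient.
    Reflection at a + 2 kappa/3 and at a trades Pochhammer symbols in -a for symbols in a. *)
Lemma binom_f_first (a : C) (l : Z) (kappa : nat) :
  pochZ_defined (a + 2 * INR kappa / 3) (1 - l - Z.of_nat kappa) ->
  pochZ_defined a (1 - l) -> pochZ a (1 - l) <> 0 ->
  F_defined l (- a) (1 / 3) ->
  (- (1)) ^ kappa * poch 1 kappa * pochZ (a + 2 * INR kappa / 3) (1 - l - Z.of_nat kappa)
    / pochZ a (1 - l) * binom_f l (- a) (1 / 3) kappa kappa = 1.
Proof.
  intros H1 H2 H3 (H4 & H5 & H6). unfold binom_f.
  specialize (H6 kappa kappa (le_n _)).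
  set (y := a + 2 * INR kappa / 3) in *.
  replace (- a + 1 / 3 * INR kappa - INR kappa + 1) with (1 - y) in * by (unfold y; field).
  replace (- a + 1) with (1 - a) in * by ring.
  replace (Z.of_nat kappa + l - 1)%Z with (- (1 - l - Z.of_nat kappa))%Z in * by lia.
  replace (l - 1)%Z with (- (1 - l))%Z in * by lia.
  assert (R1 := pochZ_reflect _ _ H1 H6). assert (R2 := pochZ_reflect _ _ H2 H4).
  assert (Ep : poch 1 kappa = INR (fact kappa)).
  { assert (E := poch_fact 0 kappa). simpl Nat.add in E. rewrite <- E.
    change (fact 0) with 1%nat. change (INR 0) with 0%R. change (INR 1) with 1%R.
    replace (0%R + 1) with (RtoC 1) by ring. ring. }
  (* The sign (-1)^kappa makes up for the difference between the two reflection signs. *)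
  assert (Es : (- (1)) ^ kappa * (if Z.even (1 - l - Z.of_nat kappa) then 1 else - (1))
    = if Z.even (1 - l) then 1 else - (1)).
  { generalize (1 - l)%Z. intros n. clear. induction kappa as [|k IH].
    - rewrite Z.sub_0_r. simpl. destruct (Z.even n); ring.
    - rewrite <- IH. replace (n - Z.of_nat (S k))%Z with (Z.pred (n - Z.of_nat k)) by lia.
      rewrite Z.even_pred, <- Z.negb_even, Cpow_S.
      destruct (Z.even (n - Z.of_nat k)); simpl; ring. }
  rewrite Ep. assert (Nf := INR_fact_C kappa).
  set (q := pochZ (1 - a) (- (1 - l))) in *.
  set (q' := pochZ (1 - y) (- (1 - l - Z.of_nat kappa))) in *.
  transitivity ((- (1)) ^ kappa * (pochZ y (1 - l - Z.of_nat kappa) * q') / (pochZ a (1 - l) * q)).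
  { field. auto. }
  rewrite R1, Es, R2. destruct (Z.even (1 - l)); field.
Qed.

Lemma INR_triple (m kappa : nat) : RtoC (INR (3 * m + kappa)) = 3 * INR m + INR kappa.
Proof.
  rewrite plus_INR, mult_INR, RtoC_plus, RtoC_mult.
  replace (INR 3) with 3%R by (simpl; ring). reflexivity.
Qed.

(** Of (kappa+1)/3, (kappa+2)/3, (kappa+3)/3 one is 1 and yields the m! of the series; the other two
    are the lower parameters. *)
Lemma b_lower_spec (kappa : nat) : (kappa <= 2)%nat ->
  exists b1 b2, b_lower kappa = b1 :: b2 :: nil /\
  forall m : nat, let k := RtoC (INR (3 * m + kappa)) in
    (k + 1) * (k + 2) * (k + 3) = 27 * ((b1 + INR m) * (b2 + INR m) * (1 + INR m)).
Proof.
  intros Hk.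
  destruct kappa as [|[|[|kappa]]]; [| | |lia]; simpl b_lower; do 2 eexists;
    (split; [reflexivity|]); intros m; cbv zeta; rewrite INR_triple.
  - change (INR 0) with 0%R. field.
  - change (INR 1) with 1%R. field.
  - replace (INR 2) with 2%R by (simpl; ring). field.
Qed.

Lemma lower_ok_nz (cs : list C) (b : C) : lower_ok cs -> In b cs -> forall k : nat, b + INR k <> 0.
Proof.
  intros H Hin k E. apply (H b Hin k).
  replace b with (b + INR k - INR k) by ring. rewrite E. ring.
Qed.

(** Both sides have the same ratio of consecutive terms in m, and [binom_f_first] is the case m =
    0. *)
Lemma pFq_32_term (a : C) (l : Z) (kappa m : nat) (b1 b2 : C) :
  pochZ_defined (a + 2 * INR kappa / 3) (1 - l - Z.of_nat kappa) ->
  pochZ_defined a (1 - l) -> pochZ a (1 - l) <> 0 ->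
  F_defined l (- a) (1 / 3) ->
  (forall k : nat, b1 + INR k <> 0) -> (forall k : nat, b2 + INR k <> 0) ->
  (forall m : nat, let k := RtoC (INR (3 * m + kappa)) in
    (k + 1) * (k + 2) * (k + 3) = 27 * ((b1 + INR m) * (b2 + INR m) * (1 + INR m))) ->
  poch (- a + IZR l + INR kappa / 3) m * poch (a / 2 + INR kappa / 3) m
    * poch ((a + 1) / 2 + INR kappa / 3) m / (poch b1 m * poch b2 m * poch 1 m)
  = (- (1)) ^ kappa * poch 1 kappa * pochZ (a + 2 * INR kappa / 3) (1 - l - Z.of_nat kappa)
    / pochZ a (1 - l)
    * (binom_f l (- a) (1 / 3) (3 * m + kappa) (3 * m + kappa) * (27 / 4) ^ m).
Proof.
  intros H1 H2 H3 HF Hb1 Hb2 Hb.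
  assert (H0 := binom_f_first a l kappa H1 H2 H3 HF).
  set (K := (- (1)) ^ kappa * poch 1 kappa * pochZ (a + 2 * INR kappa / 3) (1 - l - Z.of_nat kappa)
    / pochZ a (1 - l)) in *.
  destruct HF as (_ & _ & HF).
  assert (H11 : forall k : nat, 1 + INR k <> 0).
  { intros k E. apply (INR_S_nz k). rewrite <- E. ring. }
  induction m as [|m IH].
  - simpl (3 * 0 + kappa)%nat. simpl ((27 / 4) ^ 0). rewrite (Cmult_1_r (binom_f _ _ _ _ _)), H0. simpl. field.
  - assert (P1 := poch_nz _ m Hb1). assert (P2 := poch_nz _ m Hb2). assert (P3 := poch_nz _ m H11).
    set (k := (3 * m + kappa)%nat) in *.
    assert (St := binom_f_step3 l (- a) k (HF k k (le_n _))). cbv zeta in St.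
    replace (3 * S m + kappa)%nat with (k + 3)%nat by (unfold k; lia).
    specialize (Hb m). cbv zeta in Hb. fold k in Hb. rewrite Hb in St.
    specialize (Hb1 m). specialize (Hb2 m). specialize (H11 m).
    assert (Ek := INR_triple m kappa). fold k in Ek. rewrite Ek in St.
    simpl poch. rewrite Cpow_S.
    set (T := binom_f l (- a) (1 / 3) (k + 3) (k + 3)) in *.
    set (T0 := binom_f l (- a) (1 / 3) k k) in *.
    (* The three factors are -2 ((a+1)/2 + kappa/3 + m), -2 (a/2 + kappa/3 + m) and -a + l + kappa/3
       + m. The resulting 4/27 is compensated by (27/4)^m. *)
    assert (ET : T = T0 * ((- a + 1 / 3 * (3 * INR m + INR kappa) - (3 * INR m + INR kappa) + 1 - 2) *
      (- a + 1 / 3 * (3 * INR m + INR kappa) - (3 * INR m + INR kappa) + 1 - 1) *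
      (- a + 1 / 3 * (3 * INR m + INR kappa) - (3 * INR m + INR kappa) + 1 +
       (3 * INR m + INR kappa) + IZR l - 1)) / (27 * ((b1 + INR m) * (b2 + INR m) * (1 + INR m)))).
    { rewrite <- St. field. auto. }
    rewrite ET.
    transitivity ((poch (- a + IZR l + INR kappa / 3) m * poch (a / 2 + INR kappa / 3) m *
      poch ((a + 1) / 2 + INR kappa / 3) m / (poch b1 m * poch b2 m * poch 1 m)) *
      ((- a + IZR l + INR kappa / 3 + INR m) * (a / 2 + INR kappa / 3 + INR m)
       * ((a + 1) / 2 + INR kappa / 3 + INR m)) /
      ((b1 + INR m) * (b2 + INR m) * (1 + INR m))).
    { field. auto 10. }
    rewrite IH. field. auto.
Qed.

Lemma poch_ratio (p : C) (m : nat) : (forall k : nat, p + INR k <> 0) ->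
  poch p m / poch (p + 1) m = p / (p + INR m).
Proof.
  intros H.
  assert (H1 : poch (p + 1) m <> 0).
  { apply poch_nz. intros k E. apply (H (S k)). rewrite INR_S_C, <- E. ring. }
  assert (E : p * poch (p + 1) m = poch p m * (p + INR m)) by (symmetry; exact (poch_S_l p m)).
  assert (Hm := H m).
  replace (poch p m) with (p * poch (p + 1) m / (p + INR m)) by (rewrite E; field; exact Hm).
  field. auto.
Qed.

(** * The Belyi map zeta_{1,2} *)

Local Notation cderive := (@is_derive C_AbsRing C_NormedModule).
Local Notation aderive := (@is_derive C_AbsRing (AbsRing_NormedModule C_AbsRing)).

(** Common ground of two normed-module structures on [C]: the definitions of the theorem use
    [C_NormedModule], while the product rule and the inner function of a composition use
    [AbsRing_NormedModule C_AbsRing]. *)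
Definition eps_derivative (f : C -> C) (z d : C) : Prop :=
  forall eps : R, (0 < eps)%R -> exists del : R, (0 < del)%R /\ forall y : C,
    (Cmod (y - z) < del)%R -> (Cmod (f y - f z - (y - z) * d) <= eps * Cmod (y - z))%R.

Lemma cderive_eps (f : C -> C) (z d : C) : cderive f z d <-> eps_derivative f z d.
Proof.
  split.
  - intros [_ H] eps He.
    destruct (H z (fun P h => h) (mkposreal eps He)) as [del Hdel].
    exists del. split; [apply cond_pos|]. intros y Hy. exact (Hdel y Hy).
  - intros H. split.
    + apply (is_linear_scal_l (K := C_AbsRing) (V := C_NormedModule)).
    + intros x Hx eps.
      assert (E : z = x)
        by exact (is_filter_lim_locally_unique (V := AbsRing_NormedModule C_AbsRing) z x Hx).
      subst x. destruct (H eps (cond_pos eps)) as (del & Hd & Hdel).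
      exists (mkposreal del Hd). intros y Hy. exact (Hdel y Hy).
Qed.

Lemma aderive_eps (f : C -> C) (z d : C) : aderive f z d <-> eps_derivative f z d.
Proof.
  split.
  - intros [_ H] eps He.
    destruct (H z (fun P h => h) (mkposreal eps He)) as [del Hdel].
    exists del. split; [apply cond_pos|]. intros y Hy. exact (Hdel y Hy).
  - intros H. split.
    + apply (is_linear_scal_l (K := C_AbsRing) (V := AbsRing_NormedModule C_AbsRing)).
    + intros x Hx eps.
      assert (E : z = x)
        by exact (is_filter_lim_locally_unique (V := AbsRing_NormedModule C_AbsRing) z x Hx).
      subst x. destruct (H eps (cond_pos eps)) as (del & Hd & Hdel).
      exists (mkposreal del Hd). intros y Hy. exact (Hdel y Hy).
Qed.

Lemma cderive_aderive (f : C -> C) (z d : C) : cderive f z d <-> aderive f z d.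
Proof. now rewrite cderive_eps, aderive_eps. Qed.

Lemma cderive_val (f : C -> C) (z d d' : C) : cderive f z d -> d = d' -> cderive f z d'.
Proof. now intros H <-. Qed.

Lemma cderive_ext_loc (f g : C -> C) (z d : C) (r : R) : (0 < r)%R ->
  (forall w, (Cmod (w - z) < r)%R -> f w = g w) -> cderive f z d -> cderive g z d.
Proof.
  intros Hr He. rewrite !cderive_eps. intros H eps Heps.
  destruct (H eps Heps) as (del & Hd & Hdel).
  exists (Rmin r del). split; [now apply Rmin_glb_lt|]. intros y Hy.
  rewrite <- (He y) by (apply Rlt_le_trans with (1 := Hy); apply Rmin_l).
  rewrite <- (He z) by (replace (z - z) with (RtoC 0) by ring; now rewrite Cmod_0).
  apply Hdel. apply Rlt_le_trans with (1 := Hy). apply Rmin_r.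
Qed.

Lemma cderive_mult (f g : C -> C) (z df dg : C) :
  cderive f z df -> cderive g z dg -> cderive (fun w => f w * g w) z (df * g z + f z * dg).
Proof.
  rewrite !cderive_aderive. intros Hf Hg.
  exact (is_derive_mult (K := C_AbsRing) f g z df dg Hf Hg Cmult_comm).
Qed.

Lemma cderive_plus (f g : C -> C) (z df dg : C) :
  cderive f z df -> cderive g z dg -> cderive (fun w => f w + g w) z (df + dg).
Proof. exact (is_derive_plus f g z df dg). Qed.

Lemma cderive_const (c z : C) : cderive (fun _ => c) z (RtoC 0).
Proof. exact (is_derive_const (V := C_NormedModule) c z). Qed.

Lemma cderive_id (z : C) : cderive (fun w => w) z (RtoC 1).
Proof. rewrite cderive_aderive. exact (is_derive_id (K := C_AbsRing) z). Qed.

Lemma cderive_comp (f g : C -> C) (z df dg : C) :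
  cderive f (g z) df -> cderive g z dg -> cderive (fun w => f (g w)) z (dg * df).
Proof.
  intros Hf Hg. rewrite cderive_aderive in Hg.
  exact (is_derive_comp (V := C_NormedModule) f g z df dg Hf Hg).
Qed.

Lemma cderive_Cinv (z : C) : z <> 0 -> cderive Cinv z (- / (z * z)).
Proof.
  intros Hz. rewrite cderive_eps. intros eps He.
  assert (Hm : (0 < Cmod z)%R) by (now apply Cmod_gt_0).
  set (m := Cmod z) in *.
  assert (Hm3 : (0 < m * m * m)%R) by (repeat apply Rmult_lt_0_compat; exact Hm).
  (* The remainder is (y-z)^2 / (y z^2). The first bound gives |y| >= m/2, and then the second gives
     |y-z| <= eps |y| m^2. *)
  exists (Rmin (m / 2) (eps * (m * m * m) / 2)). split.
  { apply Rmin_glb_lt; [lra|]. assert (0 < eps * (m * m * m))%R by (now apply Rmult_lt_0_compat). lra. }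
  intros y Hy.
  assert (H1 := Rlt_le_trans _ _ _ Hy (Rmin_l _ _)).
  assert (H2 := Rlt_le_trans _ _ _ Hy (Rmin_r _ _)).
  assert (Hym : (m / 2 <= Cmod y)%R).
  { assert (T := Cmod_triangle y (- (y - z))). replace (y + - (y - z)) with z in T by ring.
    rewrite Cmod_opp in T. fold m in T. lra. }
  assert (Ny : y <> 0) by (intros E; rewrite E, Cmod_0 in Hym; lra).
  replace (/ y - / z - (y - z) * - / (z * z)) with ((y - z) * (y - z) / (y * (z * z)))
    by (field; auto).
  assert (Nz : y * (z * z) <> 0) by (repeat apply Cmult_neq_0; assumption).
  rewrite Cmod_div, !Cmod_mult by exact Nz. fold m.
  set (d := Cmod (y - z)) in *. assert (Hd : (0 <= d)%R) by apply Cmod_ge_0.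
  assert (Hden : (0 < Cmod y * (m * m))%R) by (apply Rmult_lt_0_compat; nra).
  apply Rmult_le_reg_r with (Cmod y * (m * m))%R; [exact Hden|].
  unfold Rdiv. rewrite Rmult_assoc, Rinv_l, Rmult_1_r by lra.
  assert (Hk : (eps * (m * m * m) / 2 <= eps * (Cmod y * (m * m)))%R).
  { replace (eps * (m * m * m) / 2)%R with (eps * (m / 2 * (m * m)))%R by field.
    apply Rmult_le_compat_l; [lra|]. apply Rmult_le_compat_r; nra. }
  replace (eps * d * (Cmod y * (m * m)))%R with (d * (eps * (Cmod y * (m * m))))%R by ring.
  apply Rmult_le_compat_l; lra.
Qed.

Lemma cderive_inv (f : C -> C) (z d : C) : f z <> 0 -> cderive f z d ->
  cderive (fun w => / f w) z (d * - / (f z * f z)).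
Proof. intros Hz H. exact (cderive_comp Cinv f z _ _ (cderive_Cinv _ Hz) H). Qed.

Lemma cderive_cube (z : C) : cderive (fun w => w ^ 3) z (3 * z ^ 2).
Proof.
  assert (H2 := cderive_mult _ _ _ _ _ (cderive_id z) (cderive_id z)).
  assert (H3 := cderive_mult _ _ _ _ _ (cderive_id z) H2).
  apply (cderive_ext_loc (fun w => w * (w * w)) _ _ _ 1 Rlt_0_1).
  { intros w _. ring. }
  apply (cderive_val _ _ _ _ H3). ring.
Qed.

Lemma cderive_one_cube_sq (z : C) :
  cderive (fun w => (1 + w ^ 3) * (1 + w ^ 3)) z (6 * z ^ 2 * (1 + z ^ 3)).
Proof.
  assert (H := cderive_plus _ _ _ _ _ (cderive_const 1 z) (cderive_cube z)).
  apply (cderive_val _ _ _ _ (cderive_mult _ _ _ _ _ H H)). ring.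
Qed.

Lemma four_nz : RtoC 4 <> 0.
Proof. intros E. apply RtoC_inj in E. lra. Qed.

Lemma cderive_zeta12 (t : C) : t <> 0 -> cderive zeta12 t (3 * (t ^ 6 - 1) / (4 * t ^ 4)).
Proof.
  intros Ht.
  assert (N : 4 * t ^ 3 <> 0) by (apply Cmult_neq_0; [exact four_nz|now apply Cpow_nz]).
  assert (H4 := cderive_mult _ _ _ _ _ (cderive_const 4 t) (cderive_cube t)).
  assert (H := cderive_mult _ _ _ _ _ (cderive_one_cube_sq t) (cderive_inv (fun w => 4 * w ^ 3) t _ N H4)).
  apply (cderive_ext_loc (fun w => (1 + w ^ 3) * (1 + w ^ 3) * / (4 * w ^ 3)) _ _ _ 1 Rlt_0_1).
  { intros w _. unfold zeta12, Cdiv. simpl. ring. }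
  apply (cderive_val _ _ _ _ H). field. exact Ht.
Qed.

Lemma Cinv_0 : / RtoC 0 = 0.
Proof. unfold Cinv, RtoC. simpl. f_equal; unfold Rdiv; ring. Qed.

(** Thanks to the convention / 0 = 0, inversion is an involution on all of [C]. *)
Lemma Cinv_inv (v : C) : / / v = v.
Proof.
  destruct (Ceq_dec v 0) as [->|H]; [now rewrite !Cinv_0|].
  field. exact H.
Qed.

(** The reciprocal of zeta_{1,2} is regular at 0, and zeta_{1,2} is invariant under w -> 1/w, so the
    poles at 0 and infinity share one local formula. *)
Lemma zeta12_near_pole (w : C) : w <> 0 -> 1 + w ^ 3 <> 0 ->
  P1inv (Some (zeta12 w)) = Some (4 * w ^ 3 / (1 + w ^ 3) ^ 2) /\ zeta12 (/ w) = zeta12 w.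
Proof.
  intros Hw H3. split.
  - unfold P1inv. destruct (Ceq_dec (zeta12 w) 0) as [E|E].
    + exfalso. revert E. unfold zeta12, Cdiv. apply Cmult_neq_0; [now apply Cpow_nz|].
      intros E. apply C1_nz. rewrite <- (Cinv_r (4 * w ^ 3)), E; [ring|].
      apply Cmult_neq_0; [exact four_nz|now apply Cpow_nz].
    + f_equal. unfold zeta12. field. auto using four_nz.
  - unfold zeta12. field. exact Hw.
Qed.

Lemma one_cube_nz (w : C) : (Cmod w < 1)%R -> 1 + w ^ 3 <> 0.
Proof.
  intros H. apply add_1_nz. rewrite Cmod_pow. assert (G := Cmod_ge_0 w). simpl. nra.
Qed.

Lemma zeta12_holomorphic : P1_holomorphic zeta12_P1.
Proof.
  assert (Hg : cderive (fun w => 4 * w ^ 3 * / ((1 + w ^ 3) * (1 + w ^ 3))) (RtoC 0) (RtoC 0)).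
  { assert (N : (1 + 0 ^ 3) * (1 + 0 ^ 3) <> 0).
    { replace ((1 + 0 ^ 3) * (1 + 0 ^ 3)) with (RtoC 1) by ring. exact C1_nz. }
    assert (H4 := cderive_mult _ _ _ _ _ (cderive_const 4 0) (cderive_cube 0)).
    assert (H := cderive_mult _ _ _ _ _ H4
      (cderive_inv (fun w => (1 + w ^ 3) * (1 + w ^ 3)) 0 _ N (cderive_one_cube_sq 0))).
    apply (cderive_val _ _ _ _ H). ring. }
  (* Treats the points near 0 ([s = false]) and near infinity ([s = true]) together. At w = 0 either
     point is sent to infinity, so [None] may stand for both. *)
  assert (Hc : forall s w, (Cmod (w - 0) < 1)%R ->
    chart true (zeta12_P1 (if Ceq_dec w 0 then None else Some (if s : bool then / w else w)))
    = Some (4 * w ^ 3 * / ((1 + w ^ 3) * (1 + w ^ 3)))).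
  { intros s w Hw. replace (w - 0) with w in Hw by ring. unfold chart.
    destruct (Ceq_dec w 0) as [->|Hw0]; [simpl; f_equal; ring|].
    destruct (zeta12_near_pole w Hw0 (one_cube_nz w Hw)) as [E1 E2].
    replace (4 * w ^ 3 * / ((1 + w ^ 3) * (1 + w ^ 3))) with (4 * w ^ 3 / (1 + w ^ 3) ^ 2)
      by (unfold Cdiv; do 2 f_equal; ring).
    rewrite <- E1. unfold zeta12_P1.
    destruct s.
    - destruct (Ceq_dec (/ w) 0) as [E|E].
      + exfalso. apply Hw0. rewrite <- (Cinv_inv w), E. apply Cinv_0.
      + now rewrite E2.
    - destruct (Ceq_dec w 0) as [E|E]; [contradiction|reflexivity]. }
  intros [t|].
  - destruct (Ceq_dec t 0) as [->|Ht].
    + exists 0, false, true, 0. split; [reflexivity|].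
      assert (E : forall w, (Cmod (w - 0) < 1)%R -> chart true (zeta12_P1 (chart false (Some w)))
         = Some (4 * w ^ 3 * / ((1 + w ^ 3) * (1 + w ^ 3)))).
      { intros w Hw. rewrite <- (Hc false w Hw). unfold chart at 2, zeta12_P1.
        destruct (Ceq_dec w 0) as [|N]; [reflexivity|]. destruct (Ceq_dec w 0); [contradiction|reflexivity]. }
      split.
      * exists 1%R. split; [lra|]. intros w Hw. now rewrite E.
      * apply (cderive_ext_loc (fun w => 4 * w ^ 3 * / ((1 + w ^ 3) * (1 + w ^ 3))) _ _ _ 1 Rlt_0_1);
          [|exact Hg]. intros w Hw. now rewrite E.
    + exists (3 * (t ^ 6 - 1) / (4 * t ^ 4)), false, false, t. split; [reflexivity|].
      assert (E : forall w, (Cmod (w - t) < Cmod t)%R ->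
        chart false (zeta12_P1 (chart false (Some w))) = Some (zeta12 w)).
      { intros w Hw. unfold chart, zeta12_P1. destruct (Ceq_dec w 0) as [->|]; [|reflexivity].
        exfalso. replace (0 - t) with (- t) in Hw by ring. rewrite Cmod_opp in Hw. lra. }
      assert (Hm : (0 < Cmod t)%R) by (now apply Cmod_gt_0). split.
      * exists (Cmod t). split; [exact Hm|]. intros w Hw. now rewrite E.
      * apply (cderive_ext_loc zeta12 _ _ _ (Cmod t) Hm); [|now apply cderive_zeta12].
        intros w Hw. now rewrite E.
  - exists 0, true, true, 0. split.
    { unfold chart, P1inv. destruct (Ceq_dec 0 0); [reflexivity|congruence]. }
    assert (E : forall w, (Cmod (w - 0) < 1)%R -> chart true (zeta12_P1 (chart true (Some w)))
       = Some (4 * w ^ 3 * / ((1 + w ^ 3) * (1 + w ^ 3)))).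
    { intros w Hw. now rewrite <- (Hc true w Hw). }
    split.
    + exists 1%R. split; [lra|]. intros w Hw. now rewrite E.
    + apply (cderive_ext_loc (fun w => 4 * w ^ 3 * / ((1 + w ^ 3) * (1 + w ^ 3))) _ _ _ 1 Rlt_0_1);
        [|exact Hg]. intros w Hw. now rewrite E.
Qed.

Definition inv_if (s : bool) (z : C) : C := if s then / z else z.

Lemma cderive_inv_if (s : bool) (z : C) : z <> 0 -> exists d : C, cderive (inv_if s) z d.
Proof.
  intros Hz. destruct s.
  - exists (- / (z * z)). now apply cderive_Cinv.
  - exists (RtoC 1). apply cderive_id.
Qed.

Lemma P1fin_chart (s : bool) (v : C) : P1fin (chart s (Some v)) = inv_if s v.
Proof.
  destruct s; [|reflexivity]. unfold chart, P1inv, inv_if.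
  destruct (Ceq_dec v 0) as [->|]; [now rewrite Cinv_0|reflexivity].
Qed.

Lemma inv_if_inv_if (s : bool) (v : C) : inv_if s (inv_if s v) = v.
Proof. destruct s; [apply Cinv_inv|reflexivity]. Qed.

Lemma inv_if_nz (s : bool) (v : C) : v <> 0 -> inv_if s v <> 0.
Proof.
  intros H E. apply H. rewrite <- (inv_if_inv_if s v), E. destruct s; [apply Cinv_0|reflexivity].
Qed.

Lemma chart_inv_if (s : bool) (x : C) : x <> 0 -> chart s (Some (inv_if s x)) = Some x.
Proof.
  intros H. destruct s; [|reflexivity]. unfold chart, P1inv, inv_if.
  destruct (Ceq_dec (/ x) 0) as [E|E].
  - exfalso. exact (inv_if_nz true x H E).
  - now rewrite Cinv_inv.
Qed.

(* Reading the ramified germ back in the affine charts, by composing with the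
   two chart maps, shows that [zeta12] itself has a vanishing derivative. *)
Lemma zeta12_critical (t : C) : t <> 0 -> zeta12 t <> 0 ->
  ramified_at zeta12_P1 (Some t) -> t ^ 6 = 1.
Proof.
  intros Ht Hz (s & s' & z & Hc & _ & Hd).
  assert (Ez : z = inv_if s t).
  { rewrite <- (inv_if_inv_if s z). f_equal. now rewrite <- P1fin_chart, Hc. }
  set (G := fun w => P1fin (chart s' (zeta12_P1 (chart s (Some w))))) in *.
  assert (HG : forall x : C, x <> 0 -> G (inv_if s x) = inv_if s' (zeta12 x)).
  { intros x Hx. unfold G. rewrite chart_inv_if by exact Hx. unfold zeta12_P1.
    destruct (Ceq_dec x 0); [contradiction|]. apply P1fin_chart. }
  destruct (cderive_inv_if s t Ht) as [d1 H1].
  destruct (cderive_inv_if s' (G (inv_if s t))) as [d2 H2].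
  { rewrite HG by exact Ht. now apply inv_if_nz. }
  rewrite Ez in Hd.
  assert (H3 := cderive_comp (inv_if s') (fun x => G (inv_if s x)) t _ _ H2 (cderive_comp G (inv_if s) t _ _ Hd H1)).
  assert (Hm : (0 < Cmod t)%R) by (now apply Cmod_gt_0).
  assert (H4 : cderive zeta12 t (d1 * 0 * d2)).
  { refine (cderive_ext_loc _ _ _ _ (Cmod t) Hm _ H3). intros w Hw. cbv beta.
    rewrite HG; [apply inv_if_inv_if|]. intros ->.
    replace (0 - t) with (- t) in Hw by ring. rewrite Cmod_opp in Hw. lra. }
  assert (E := is_C_derive_unique _ _ _ H4).
  rewrite (is_C_derive_unique _ _ _ (cderive_zeta12 t Ht)) in E.
  assert (N3 : RtoC 3 <> 0) by (intros E3; apply RtoC_inj in E3; lra).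
  assert (N := four_nz).
  transitivity (3 * (t ^ 6 - 1) / (4 * t ^ 4) * (4 * t ^ 4) / 3 + 1); [field; auto|].
  rewrite E. field.
Qed.

Lemma zeta12_Belyi : Belyi zeta12_P1.
Proof.
  split; [exact zeta12_holomorphic|]. intros [t|] H; [|right; right; reflexivity].
  unfold zeta12_P1 at 1 2 3. destruct (Ceq_dec t 0) as [|Ht]; [right; right; reflexivity|].
  destruct (Ceq_dec (zeta12 t) 0) as [E|Hz]; [left; now rewrite E|]. right. left. f_equal.
  assert (E := zeta12_critical t Ht Hz H).
  (* A critical point has t^3 = 1 or t^3 = -1; these lie over 1 and 0 respectively, and the value 0
     has been split off. *)
  assert (E2 : (t ^ 3 - 1) * (t ^ 3 + 1) = 0) by (replace ((t ^ 3 - 1) * (t ^ 3 + 1)) with (t ^ 6 - 1) by ring; rewrite E; ring).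
  destruct (Ceq_dec (t ^ 3 + 1) 0) as [E3|E3].
  - exfalso. apply Hz. unfold zeta12.
    replace (1 + t ^ 3) with (t ^ 3 + 1) by ring. rewrite E3. unfold Cdiv. ring.
  - destruct (Ceq_dec (t ^ 3 - 1) 0) as [E4|E4]; [|exfalso; exact (Cmult_neq_0 _ _ E4 E3 E2)].
    assert (E5 : t ^ 3 = 1) by (replace (t ^ 3) with (t ^ 3 - 1 + 1) by ring; rewrite E4; ring).
    unfold zeta12. rewrite E5. field.
Qed.

(** * Fibres and degree of zeta_{1,2} *)

Lemma Cexp_surj (z : C) : z <> 0 -> exists u, Cexp u = z.
Proof.
  (* At most three multiplications by i move a nonzero z into Re > 0, where [Clog] inverts
     [Cexp]. *)
  assert (Hrot : forall z, (exists u, Cexp u = Ci * z) -> exists u, Cexp u = z).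
  { intros y [u Hu]. exists (u + - (0, PI / 2)%R). rewrite Cexp_plus, Cexp_opp, Hu.
    assert (E : Cexp (0, PI / 2)%R = Ci).
    { unfold Cexp. simpl. rewrite exp_0, cos_PI2, sin_PI2. unfold Ci. f_equal; ring. }
    rewrite E. assert (N : Ci <> 0).
    { intros E'. injection E'. lra. }
    field. exact N. }
  destruct z as [x y]. intros Hz.
  assert (Hp : forall z, (0 < Re z)%R -> exists u, Cexp u = z).
  { intros v Hv. exists (Clog v). now apply Cexp_Clog. }
  destruct (Rtotal_order x 0) as [Hx|[Hx|Hx]].
  - do 2 apply Hrot. apply Hp. simpl. lra.
  - destruct (Rtotal_order y 0) as [Hy|[Hy|Hy]].
    + apply Hrot, Hp. simpl. lra.
    + exfalso. apply Hz. now rewrite Hx, Hy.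
    + do 3 apply Hrot. apply Hp. simpl. lra.
  - apply Hp. exact Hx.
Qed.

Lemma Croot_exists (n : nat) (z : C) : exists u, u ^ S n = z.
Proof.
  destruct (Ceq_dec z 0) as [->|Hz].
  - exists 0. rewrite Cpow_S. ring.
  - destruct (Cexp_surj z Hz) as [u Hu]. exists (Cexp (u / INR (S n))).
    rewrite <- Cexp_INR, <- Hu. f_equal. field.
    rewrite INR_S_C. apply INR_S_nz.
Qed.

Lemma cube_eq (t r : C) : t ^ 3 = r ^ 3 -> t = r \/ t = omega * r \/ t = omega ^ 2 * r.
Proof.
  intros H.
  assert (E : (t - r) * ((t - omega * r) * (t - omega ^ 2 * r)) = 0).
  { transitivity (t ^ 3 - (1 + omega + omega ^ 2) * t ^ 2 * r
      + (omega * (1 + omega + omega ^ 2)) * t * r ^ 2 - omega ^ 3 * r ^ 3); [ring|].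
    rewrite omega_sum, omega_cube, H. ring. }
  assert (Hz : forall x y : C, x - y = 0 -> x = y).
  { intros x y Hxy. replace x with (x - y + y) by ring. rewrite Hxy. ring. }
  destruct (Ceq_dec (t - r) 0) as [E1|E1]; [left; now apply Hz|].
  destruct (Ceq_dec (t - omega * r) 0) as [E2|E2]; [right; left; now apply Hz|].
  destruct (Ceq_dec (t - omega ^ 2 * r) 0) as [E3|E3]; [right; right; now apply Hz|].
  exfalso. revert E. now repeat apply Cmult_neq_0.
Qed.

Lemma cube_omega_mult (r : C) : (omega * r) ^ 3 = r ^ 3 /\ (omega ^ 2 * r) ^ 3 = r ^ 3.
Proof.
  assert (H := omega_cube). split.
  - rewrite Cpow_mult_l, H. ring.
  - rewrite Cpow_mult_l, <- Cpow_mult_r. change (2 * 3)%nat with (3 * 2)%nat.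
    rewrite Cpow_mult_r, H. ring.
Qed.

Lemma NoDup_cube_roots (r : C) : r <> 0 ->
  r <> omega * r /\ r <> omega ^ 2 * r /\ omega * r <> omega ^ 2 * r.
Proof.
  intros Hr. assert (H3 := omega_cube). assert (H1 := omega_neq_1).
  assert (Hd : forall x y : C, x * r = y * r -> x = y).
  { intros x y E. transitivity (x * r / r); [field; exact Hr|]. rewrite E. field. exact Hr. }
  assert (No : omega <> 0) by apply Cexp_nz.
  repeat split; intros E.
  - apply H1. symmetry. apply Hd. rewrite Cmult_1_l. exact E.
  - apply H1. assert (E2 : RtoC 1 = omega ^ 2) by (apply Hd; rewrite Cmult_1_l; exact E).
    transitivity (omega * omega ^ 2); [rewrite <- E2; ring|]. rewrite <- H3. ring.
  - apply H1. apply Hd in E. transitivity (omega ^ 2 / omega); [field; exact No|].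
    rewrite <- E. field. exact No.
Qed.

Lemma zeta12_degree : P1_degree zeta12_P1 6.
Proof.
  exists (None :: Some (RtoC 0) :: Some (RtoC 1) :: nil). intros q Hq.
  destruct q as [v|]; [|exfalso; apply Hq; left; reflexivity].
  assert (Hv0 : v <> 0) by (intros ->; apply Hq; right; left; reflexivity).
  assert (Hv1 : v <> 1) by (intros ->; apply Hq; right; right; left; reflexivity).
  (* With X = t^3 the equation zeta12 t = v reads X^2 - (4 v - 2) X + 1 = 0. Its roots 2 v - 1 +- 2
     d have product 1 and coincide only for the excluded v = 0, 1. *)
  destruct (Croot_exists 1 (v * (v - 1))) as [d Hd].
  assert (Nd : d <> 0).
  { intros ->. assert (N : v * (v - 1) <> 0).
    { apply Cmult_neq_0; [exact Hv0|]. intros E. apply Hv1.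
      replace v with (v - 1 + 1) by ring. rewrite E. ring. }
    apply N. rewrite <- Hd. ring. }
  set (s := 2 * v - 1 + 2 * d). set (s' := 2 * v - 1 - 2 * d).
  assert (Ess : s * s' = 1).
  { transitivity ((2 * v - 1) ^ 2 - 4 * d ^ 2); [unfold s, s'; ring|]. rewrite Hd. ring. }
  assert (Ns : s <> 0) by (intros E; apply C1_nz; rewrite <- Ess, E; ring).
  assert (Nss : s <> s').
  { intros E. apply Nd. transitivity ((s - s') / 4); [unfold s, s'; field|].
    rewrite E. field. }
  destruct (Croot_exists 2 s) as [r Hr].
  assert (Nr : r <> 0) by (intros ->; apply Ns; rewrite <- Hr; ring).
  assert (Nir : / r <> 0) by exact (inv_if_nz true r Nr).
  assert (Hir : (/ r) ^ 3 = s').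
  { rewrite Cpow_inv, Hr by exact Nr. transitivity (s * s' / s); [rewrite Ess; field; exact Ns|].
    field. exact Ns. }
  (* The cube roots of s' are the inverses of those of s, so the fibre is two orbits of
     multiplication by omega. *)
  set (r' := / r) in *. clearbody r'.
  exists (map Some (r :: omega * r :: omega ^ 2 * r :: r' :: omega * r' :: omega ^ 2 * r' :: nil)).
  destruct (cube_omega_mult r) as [C1 C2]. destruct (cube_omega_mult r') as [C1' C2'].
  rewrite Hr in C1, C2. rewrite Hir in C1', C2'.
  split; [|split; [reflexivity|]].
  - apply NoDup_map_NoDup_ForallPairs; [intros x y _ _ E; now injection E|].
    destruct (NoDup_cube_roots r Nr) as (D1 & D2 & D3).
    destruct (NoDup_cube_roots r' Nir) as (D1' & D2' & D3').
    assert (Hx : forall x y : C, x ^ 3 = s -> y ^ 3 = s' -> y <> x).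
    { intros x y Ex Ey E. apply Nss. now rewrite <- Ex, <- Ey, E. }
    repeat (apply NoDup_cons; [cbn [In]; intros HI; repeat destruct HI as [HI|HI];
      (contradiction || congruence || refine (Hx _ _ _ _ HI); assumption)|]).
    apply NoDup_nil.
  - intros p. split.
    + intros Hin. apply in_map_iff in Hin. destruct Hin as (t & <- & Hin).
      assert (Ht : t <> 0 /\ (t ^ 3 = s \/ t ^ 3 = s')).
      { assert (No : omega <> 0) by apply Cexp_nz.
        simpl in Hin.
        destruct Hin as [<-|[<-|[<-|[<-|[<-|[<-|[]]]]]]]; split; auto;
          try (now apply Cmult_neq_0); apply Cmult_neq_0; try assumption; now apply (Cpow_nz omega 2). }
      destruct Ht as [Ht Hs]. unfold zeta12_P1. destruct (Ceq_dec t 0); [contradiction|].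
      f_equal. assert (Hq2 : (1 + t ^ 3) ^ 2 = 4 * v * t ^ 3).
      { assert (E : (t ^ 3 - s) * (t ^ 3 - s') = 0) by (destruct Hs as [->| ->]; ring).
        assert (E2 : (t ^ 3 - s) * (t ^ 3 - s') = (t ^ 3) ^ 2 - (4 * v - 2) * t ^ 3 + s * s')
          by (unfold s, s'; ring).
        rewrite E, Ess in E2. transitivity ((t ^ 3) ^ 2 - (4 * v - 2) * t ^ 3 + 1 + 4 * v * t ^ 3); [ring|].
        rewrite <- E2. ring. }
      unfold zeta12. rewrite Hq2. field. auto using four_nz.
    + intros Hp. destruct p as [t|]; [|discriminate]. unfold zeta12_P1 in Hp.
      destruct (Ceq_dec t 0) as [|Ht]; [discriminate|]. injection Hp as Hp.
      assert (Hq2 : (1 + t ^ 3) ^ 2 = 4 * v * t ^ 3).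
      { rewrite <- Hp. unfold zeta12. field. auto using four_nz. }
      assert (E : (t ^ 3 - s) * (t ^ 3 - s') = 0).
      { transitivity ((1 + t ^ 3) ^ 2 - 4 * v * t ^ 3 + (s * s' - 1)); [unfold s, s'; ring|].
        rewrite Hq2, Ess. ring. }
      assert (Hz : forall x y : C, x - y = 0 -> x = y).
      { intros x y Hxy. replace x with (x - y + y) by ring. rewrite Hxy. ring. }
      apply in_map. simpl.
      destruct (Ceq_dec (t ^ 3 - s) 0) as [E1|E1].
      * apply Hz in E1. rewrite <- Hr in E1. destruct (cube_eq _ _ E1) as [->|[->| ->]]; auto 10.
      * destruct (Ceq_dec (t ^ 3 - s') 0) as [E2|E2]; [|exfalso; exact (Cmult_neq_0 _ _ E1 E2 E)].
        apply Hz in E2. rewrite <- Hir in E2. destruct (cube_eq _ _ E2) as [->|[->| ->]]; auto 10.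
Qed.

(** * The two hypergeometric identities *)

Theorem theorem7p4 :
  (forall t : C, t <> 0 -> zeta12 t = 1 + (1 - t ^ 3) ^ 2 / (4 * t ^ 3)) /\
  Belyi zeta12_P1 /\ P1_degree zeta12_P1 6 /\
  (forall (a : C) (l : Z) (kappa : nat),
     (kappa <= 2)%nat ->
     lower_ok (b_lower kappa) ->
     pochZ_defined (a + 2 * INR kappa / 3) (1 - l - Z.of_nat kappa) ->
     pochZ_defined a (1 - l) -> pochZ a (1 - l) <> 0 ->
     F_defined l (- a) (1 / 3) ->
     exists delta : R, (0 < delta)%R /\
     forall t : C, (0 < Cmod t < delta)%R ->
       pFq ((- a + IZR l + INR kappa / 3)
            :: (a / 2 + INR kappa / 3) :: ((a + 1) / 2 + INR kappa / 3) :: nil)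
           (b_lower kappa)
           (/ zeta12 t)
       = (- (1)) ^ kappa * poch 1 kappa
         * pochZ (a + 2 * INR kappa / 3) (1 - l - Z.of_nat kappa)
         / pochZ a (1 - l)
         * zeta12_root t ^ kappa
         * (1 / 3 *
            (Cpower (Y0 t) (- a) * F_ l (- a) (1 / 3) (Y0 t)
             + omegabar ^ kappa
               * (Cpower (Y1 t) (- a) * F_ l (- a) (1 / 3) (Y1 t))
             + omega ^ kappa
               * (Cpower (Y2 t) (- a) * F_ l (- a) (1 / 3) (Y2 t))))) /\
  (forall (a c : C) (l : Z) (kappa : nat),
     l = 0%Z \/ l = 1%Z ->
     (kappa <= 2)%nat ->
     lower_ok (b_lower kappa
               ++ (- a - c + IZR l + 1 + INR kappa / 3) :: nil) ->
     lower_ok (G_lower l (- a) (1 / 3) (- c)) ->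
     pochZ_defined (a + 2 * INR kappa / 3) (- l - Z.of_nat kappa) ->
     pochZ_defined a (- l) -> pochZ a (- l) <> 0 ->
     a + c - IZR l <> 0 ->
     exists delta : R, (0 < delta)%R /\
     forall t : C, (0 < Cmod t < delta)%R ->
       pFq ((- a + IZR l + 1 + INR kappa / 3)
            :: (a / 2 + INR kappa / 3) :: ((a + 1) / 2 + INR kappa / 3)
            :: (- a - c + IZR l + INR kappa / 3) :: nil)
           (b_lower kappa
            ++ (- a - c + IZR l + 1 + INR kappa / 3) :: nil)
           (/ zeta12 t)
       = (- (1)) ^ kappa * poch 1 kappa
         * pochZ (a + 2 * INR kappa / 3) (- l - Z.of_nat kappa)
         * (a + c - IZR l - INR kappa / 3)
         / (pochZ a (- l) * (a + c - IZR l))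
         * zeta12_root t ^ kappa
         * (1 / 3 *
            (Cpower (Y0 t) (- a) * G_ l (- a) (1 / 3) (- c) (Y0 t)
             + omegabar ^ kappa
               * (Cpower (Y1 t) (- a) * G_ l (- a) (1 / 3) (- c) (Y1 t))
             + omega ^ kappa
               * (Cpower (Y2 t) (- a) * G_ l (- a) (1 / 3) (- c) (Y2 t))))).
Proof.
  split; [|split; [exact zeta12_Belyi|split; [exact zeta12_degree|split]]].
  - intros t Ht. unfold zeta12. field. auto using four_nz.
  - intros a l kappa Hk Hlow H1 H2 H3 HF.
    destruct (trisected_series a _ (F_ l (- a) (1 / 3)) kappa Hk (F_series l (- a) (1 / 3) HF))
      as (delta & Hd & HS).
    exists delta. split; [exact Hd|]. intros t Ht. specialize (HS t Ht).
    destruct (b_lower_spec kappa Hk) as (b1 & b2 & Eb & Hb). rewrite Eb in *.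
    assert (Hb1 := lower_ok_nz _ b1 Hlow (or_introl eq_refl)).
    assert (Hb2 := lower_ok_nz _ b2 Hlow (or_intror (or_introl eq_refl))).
    unfold pFq. apply CSeries_unique.
    set (K := (- (1)) ^ kappa * poch 1 kappa * pochZ (a + 2 * INR kappa / 3) (1 - l - Z.of_nat kappa)
      / pochZ a (1 - l)).
    apply cseries_scal with (c := K) in HS.
    refine (cseries_val _ _ _ (cseries_ext _ _ _ _ HS) _); [|cring].
    intros m. unfold poch_prod. cbn [map fold_right]. rewrite !Cmult_1_r.
    rewrite !Cmult_assoc. rewrite <- (Cmult_assoc K). unfold K.
    now rewrite <- (pFq_32_term a l kappa m b1 b2).
  - intros a c l kappa Hl Hk Hlow HlowG H1 H2 H3 H4.
    assert (N3 : RtoC 3 <> 0) by (intros E; apply RtoC_inj in E; lra).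
    assert (HB : 1 / 3 <> 0).
    { intros E. apply C1_nz. transitivity (1 / 3 * 3); [field|rewrite E; ring]. }
    assert (HB1 : 1 / 3 <> 1).
    { intros E. assert (E3 : RtoC 1 = 3) by (transitivity (1 / 3 * 3); [field|rewrite E; ring]).
      apply RtoC_inj in E3. lra. }
    assert (HAD : - a + - c + IZR l <> 0).
    { intros E. apply H4. replace (a + c - IZR l) with (- (- a + - c + IZR l)) by ring.
      rewrite E. ring. }
    set (x := (- a + - c + IZR l) / (1 / 3)).
    assert (Ex : x = 3 * (- a + - c + IZR l)) by (unfold x; field; exact C1_nz || auto).
    assert (Hx : forall k : nat, x + INR k <> 0).
    { apply poch_nz_of_S.
      * rewrite Ex. now apply Cmult_neq_0.
      * apply HlowG. destruct Hl as [-> | ->]; unfold G_lower; cbn [Z.eqb].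
        * unfold G0_lower. left. unfold x. do 2 f_equal. ring.
        * unfold G1_lower. left. reflexivity. }
    (* For l = 1 the factor 1 - a is a multiple of a lower parameter of G_1, hence nonzero. *)
    assert (HPl : pochZ (- a + 1) l <> 0).
    { destruct Hl as [-> | ->]; [exact C1_nz|].
      intros E. apply (HlowG ((- a + 1) / (1 / 3 - 1))) with (n := O).
      * right. left. reflexivity.
      * change (1 * (- a + 1 + 0%R) = 0) in E.
        replace (- a + 1) with (1 * (- a + 1 + 0%R)) by ring. rewrite E. simpl. unfold Cdiv. ring. }
    (* With l + 1 >= 1 all Pochhammer indices are nonnegative, so definedness is automatic. *)
    assert (HF : F_defined (l + 1) (- a) (1 / 3)).
    { assert (Hnn : forall (y : C) (n : Z), (0 <= n)%Z -> pochZ_defined y n).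
      { intros y [|p|p] Hp; [exact I|exact I|lia]. }
      split; [apply Hnn; lia|]. split.
      * now replace (l + 1 - 1)%Z with l by lia.
      * intros k r _. apply Hnn. lia. }
    replace (- l)%Z with (1 - (l + 1))%Z in * by lia.
    destruct (trisected_series a _ (G_ l (- a) (1 / 3) (- c)) kappa Hk
      (G_series l (- a) (1 / 3) (- c) Hl HB HB1 HAD HPl HlowG)) as (delta & Hd & HS).
    exists delta. split; [exact Hd|]. intros t Ht. specialize (HS t Ht).
    destruct (b_lower_spec kappa Hk) as (b1 & b2 & Eb & Hb). rewrite Eb in *.
    assert (Hb1 := lower_ok_nz _ b1 Hlow (or_introl eq_refl)).
    assert (Hb2 := lower_ok_nz _ b2 Hlow (or_intror (or_introl eq_refl))).
    unfold pFq. apply CSeries_unique.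
    set (K := (- (1)) ^ kappa * poch 1 kappa *
      pochZ (a + 2 * INR kappa / 3) (1 - (l + 1) - Z.of_nat kappa) / pochZ a (1 - (l + 1))).
    set (p := - a - c + IZR l + INR kappa / 3).
    (* The poles match: x + (3 k + kappa) = 3 (p + k), with p the last upper parameter of the
       4F3. *)
    assert (Hp : forall k : nat, p + INR k <> 0).
    { intros k E. apply (Hx (3 * k + kappa)%nat). rewrite Ex, INR_triple.
      transitivity (3 * (p + INR k)); [unfold p; field|]. rewrite E. ring. }
    (* [G_coef] carries x/(x+k) and the 4F3 carries p/(p+m). The quotient p/(-a-c+l) is the factor
       (a+c-l-kappa/3)/(a+c-l) of the theorem. *)
    apply cseries_scal with (c := K * (p / (- a + - c + IZR l))) in HS.
    refine (cseries_val _ _ _ (cseries_ext _ _ _ _ HS) _).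
    + intros m. unfold poch_prod. cbn [map fold_right app]. rewrite !Cmult_1_r.
      assert (T := pFq_32_term a (l + 1) kappa m b1 b2 H1 H2 H3 HF Hb1 Hb2 Hb). fold K in T.
      replace (- a + IZR l + 1 + INR kappa / 3) with (- a + IZR (l + 1) + INR kappa / 3)
        by (rewrite plus_IZR, RtoC_plus; ring).
      replace (- a - c + IZR l + 1 + INR kappa / 3) with (p + 1) by (unfold p; ring).
      fold p.
      assert (Q1 := poch_nz _ m Hb1). assert (Q2 := poch_nz _ m Hb2).
      assert (Q4 : poch 1 m <> 0).
      { apply poch_nz. intros k E. apply (INR_S_nz k). rewrite <- E. ring. }
      assert (Q3 : poch (p + 1) m <> 0).
      { apply poch_nz. intros k E. apply (Hp (S k)). rewrite INR_S_C, <- E. ring. }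
      transitivity ((poch (- a + IZR (l + 1) + INR kappa / 3) m * poch (a / 2 + INR kappa / 3) m
        * poch ((a + 1) / 2 + INR kappa / 3) m / (poch b1 m * poch b2 m * poch 1 m))
        * (poch p m / poch (p + 1) m) * (/ zeta12 t) ^ m).
      2:{ generalize ((/ zeta12 t) ^ m). intros Z. field. auto. }
      rewrite T, poch_ratio by exact Hp. unfold G_coef. fold x.
      assert (Exm : x + INR (3 * m + kappa) = 3 * (p + INR m)).
      { rewrite Ex, INR_triple. unfold p. field. }
      rewrite Exm, Ex. generalize ((/ zeta12 t) ^ m) K. intros Z K'.
      field. auto.
    + unfold K, p. generalize (zeta12_root t ^ kappa). intros Z.
      match goal with |- _ * (Z * ?X) = _ => generalize X end. intros X.
      match goal with |- @eq _ ?u ?v => change (@eq C u v) end.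
      field. auto.
Qed.
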